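(* Let $k$ be a field, let $S=k[x_1,\dots,x_n]$ be the standard graded polynomial ring, and let $I$ be a homogeneous ideal of $S$ minimally generated by homogeneous elements $f_1,\dots,f_r$. If $\dim S/I\le 1$, then for every integer $i$ with $0<i<r$, $$\operatorname{reg}(Z_i(I))=\max_{0<j<n}\{\operatorname{reg}(H_{i-j}(I))+j+1\}.$$
   Context: With $d_i=\deg f_i$, let $K_\bullet(I)$ be the graded Koszul complex associated to the graded $S$-linear map $\bigoplus_{i=1}^r S(-d_i)\to S$, $e_i\mapsto f_i$ (up to isomorphism it does not depend on the chosen minimal homogeneous generators). $Z_t(I)$ and $H_t(I)$ denote the graded modules of cycles and homology of $K_\bullet(I)$ in homological position $t$; in particular $H_0(I)=S/I$, and $H_t(I)=0$ for $t<0$. For a finitely generated graded $S$-module $M$, with $\mathfrak m=(x_1,\dots,x_n)$, the Castelnuovo-Mumford regularity is $\operatorname{reg}(M)=\max_i\{a_i(M)+i\}$, where $a_i(M)=\max\{j: H^i_{\mathfrak m}(M)_j\ne 0\}$ is the largest degree in which the $i$-th local cohomology module is nonzero ($-\infty$ if it vanishes); thus $\operatorname{reg}(0)=-\infty$. *)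

(* Defs.v *)
From HB Require Import structures.
From mathcomp Require Import all_boot all_order all_algebra.
From mathcomp Require Import mpoly boolp classical_sets.
(* The notations of constructive_ereal clash with those of mpoly: [extended] is
   \bar, [EFin] is %:E and [ENInf] is -oo. *)
From mathcomp Require Import -(notations) constructive_ereal.

Set Implicit Arguments.
Unset Strict Implicit.
Unset Printing Implicit Defensive.
Import Order.TTheory GRing.Theory Num.Theory.
Local Open Scope ring_scope.

Notation extint := (extended int).

(* The supremum in the order Z u {-oo, +oo}: the maximum of A if A is nonempty
   and bounded above, -oo if A is empty. *)
Definition extsup (A : set extint) : extint := supremum (ENInf int) A.

Record gradedModule (k : fieldType) (n : nat) := GradedModule {
  gm_sort :> lmodType {mpoly k[n]};
  gm_piece : int -> set gm_sort;
  gm_piece0 : forall j, gm_piece j 0;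
  gm_pieceB : forall j u v, gm_piece j u -> gm_piece j v -> gm_piece j (u - v);
  gm_pieceZ : forall (d : nat) j (p : {mpoly k[n]}) u,
    p \is d.-homog -> gm_piece j u -> gm_piece (d%:Z + j) (p *: u);
  gm_decomp : forall u, exists (s : seq int) (c : int -> gm_sort),
    [/\ uniq s, forall j, gm_piece j (c j) & u = \sum_(j <- s) c j];
  gm_indep : forall (s : seq int) (c : int -> gm_sort),
    uniq s -> (forall j, gm_piece j (c j)) -> \sum_(j <- s) c j = 0 ->
    forall j, j \in s -> c j = 0
}.
Arguments gm_piece {k n} M j u : rename.

Record gradedSub (k : fieldType) (n : nat) (M : gradedModule k n) := GradedSub {
  gs_set :> set M;
  gs_0 : gs_set 0;
  gs_lin : forall (p : {mpoly k[n]}) u v,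
    gs_set u -> gs_set v -> gs_set (p *: u + v);
  gs_homog : forall (s : seq int) (c : int -> M),
    uniq s -> (forall j, gm_piece M j (c j)) -> gs_set (\sum_(j <- s) c j) ->
    forall j, j \in s -> gs_set (c j)
}.

Section SubQuotient.
Variables (k : fieldType) (n : nat) (M : gradedModule k n) (N : gradedSub M).

Definition gs_pred : {pred M} := fun u => `[< gs_set N u >].

Lemma gs_predP u : reflect (gs_set N u) (u \in gs_pred).
Proof. exact: asboolP. Qed.

Lemma gs_submod_closed : submod_closed gs_pred.
Proof.
split=> [|p u v /gs_predP hu /gs_predP hv]; apply/gs_predP; first exact: gs_0.
exact: gs_lin.
Qed.

HB.instance Definition _ :=
  GRing.isSubmodClosed.Build {mpoly k[n]} M gs_pred gs_submod_closed.

Record gm_sub_type := GmSub {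
  gm_sub_val :> M;
  gm_sub_valP : gm_sub_val \in gs_pred
}.
HB.instance Definition _ := [isSub for gm_sub_val].
HB.instance Definition _ := [Choice of gm_sub_type by <:].
HB.instance Definition _ := [SubChoice_isSubLmodule of gm_sub_type by <:].

Definition gm_sub_piece (j : int) : set gm_sub_type :=
  fun u => gm_piece M j (val u).

Lemma gm_sub_piece0 j : gm_sub_piece j 0.
Proof. by rewrite /gm_sub_piece raddf0; apply: gm_piece0. Qed.

Lemma gm_sub_pieceB j u v :
  gm_sub_piece j u -> gm_sub_piece j v -> gm_sub_piece j (u - v).
Proof. by rewrite /gm_sub_piece raddfB; apply: gm_pieceB. Qed.

Lemma gm_sub_pieceZ (d : nat) j (p : {mpoly k[n]}) u :
  p \is d.-homog -> gm_sub_piece j u -> gm_sub_piece (d%:Z + j) (p *: u).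
Proof. by rewrite /gm_sub_piece linearZ; apply: gm_pieceZ. Qed.

Lemma gm_sub_decomp u : exists (s : seq int) (c : int -> gm_sub_type),
  [/\ uniq s, forall j, gm_sub_piece j (c j) & u = \sum_(j <- s) c j].
Proof.
have [s [c [us hc eu]]] := gm_decomp (val u).
have Nc j : j \in s -> c j \in gs_pred.
  move=> js; apply/gs_predP; apply: gs_homog us hc _ _ js.
  by rewrite -eu; apply/gs_predP/valP.
exists s, (fun j => if j \in s then insubd (0 : gm_sub_type) (c j) else 0).
split=> // [j|]; first case: ifP => js.
- by rewrite /gm_sub_piece insubdK ?Nc.
- exact: gm_sub_piece0.
- apply: val_inj; rewrite raddf_sum eu; apply: eq_big_seq => j js /=.
  by rewrite js insubdK ?Nc.
Qed.

Lemma gm_sub_indep (s : seq int) (c : int -> gm_sub_type) :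
  uniq s -> (forall j, gm_sub_piece j (c j)) -> \sum_(j <- s) c j = 0 ->
  forall j, j \in s -> c j = 0.
Proof.
move=> us hc s0 j js; apply: val_inj; rewrite raddf0.
apply: (gm_indep (c := fun j => val (c j)) us hc) js.
by rewrite -raddf_sum s0 raddf0.
Qed.

Definition gm_sub : gradedModule k n :=
  GradedModule gm_sub_piece0 gm_sub_pieceB gm_sub_pieceZ
    gm_sub_decomp gm_sub_indep.

Definition gm_quot_type := Quotient.quot gs_pred.
HB.instance Definition _ := ZmodQuotient.on gm_quot_type.

Definition gm_pi : M -> gm_quot_type := \pi_gm_quot_type%qT.

Lemma gm_piE u v : (gm_pi u == gm_pi v) = (u - v \in gs_pred).
Proof. by rewrite -Quotient.equivE /gm_pi; exact: eqmodE. Qed.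

Lemma gm_pi_is_zmod_morphism : zmod_morphism gm_pi.
Proof. by move=> u v; rewrite /gm_pi !piE. Qed.
HB.instance Definition _ :=
  GRing.isZmodMorphism.Build M gm_quot_type gm_pi gm_pi_is_zmod_morphism.

Lemma gm_pi_surj (x : gm_quot_type) : exists u, x = gm_pi u.
Proof. by exists (repr x); rewrite /gm_pi reprK. Qed.

Lemma gm_pi_eq0 u : (gm_pi u = 0) <-> gs_set N u.
Proof.
rewrite -(raddf0 gm_pi); split=> [/eqP|/gs_predP h]; last apply/eqP.
  by rewrite gm_piE subr0 => /gs_predP.
by rewrite gm_piE subr0.
Qed.

Definition gm_quot_scale (p : {mpoly k[n]}) (x : gm_quot_type) : gm_quot_type :=
  gm_pi (p *: repr x).

Lemma gm_pi_scale p u : gm_quot_scale p (gm_pi u) = gm_pi (p *: u).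
Proof.
apply/eqP; rewrite gm_piE -scalerBr rpredZ // -gm_piE.
by rewrite {1}/gm_pi reprK.
Qed.

Lemma gm_quot_scaleA a b x :
  gm_quot_scale a (gm_quot_scale b x) = gm_quot_scale (a * b) x.
Proof. by have [u ->] := gm_pi_surj x; rewrite !gm_pi_scale scalerA. Qed.

Lemma gm_quot_scale1 : left_id 1 gm_quot_scale.
Proof. by move=> x; have [u ->] := gm_pi_surj x; rewrite gm_pi_scale scale1r. Qed.

Lemma gm_quot_scaleDr : right_distributive gm_quot_scale +%R.
Proof.
move=> a x y; have [u ->] := gm_pi_surj x; have [v ->] := gm_pi_surj y.
by rewrite -raddfD !gm_pi_scale -raddfD scalerDr.
Qed.

Lemma gm_quot_scaleDl x : {morph gm_quot_scale^~ x : a b / a + b}.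
Proof.
move=> a b; have [u ->] := gm_pi_surj x.
by rewrite !gm_pi_scale -raddfD scalerDl.
Qed.

HB.instance Definition _ := GRing.Zmodule_isLmodule.Build {mpoly k[n]}
  gm_quot_type gm_quot_scaleA gm_quot_scale1 gm_quot_scaleDr gm_quot_scaleDl.

Lemma gm_piZ p u : gm_pi (p *: u) = p *: gm_pi u.
Proof. by rewrite -gm_pi_scale. Qed.

Definition gm_quot_piece (j : int) : set gm_quot_type :=
  fun x => exists2 u, gm_piece M j u & x = gm_pi u.

Lemma gm_quot_piece0 j : gm_quot_piece j 0.
Proof. by exists 0; [apply: gm_piece0 | rewrite raddf0]. Qed.

Lemma gm_quot_pieceB j x y :
  gm_quot_piece j x -> gm_quot_piece j y -> gm_quot_piece j (x - y).
Proof.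
move=> [u hu ->] [v hv ->]; exists (u - v); first exact: gm_pieceB.
by rewrite raddfB.
Qed.

Lemma gm_quot_pieceZ (d : nat) j (p : {mpoly k[n]}) x :
  p \is d.-homog -> gm_quot_piece j x -> gm_quot_piece (d%:Z + j) (p *: x).
Proof.
move=> hp [u hu ->]; exists (p *: u); first exact: gm_pieceZ.
by rewrite gm_piZ.
Qed.

Lemma gm_quot_decomp x : exists (s : seq int) (c : int -> gm_quot_type),
  [/\ uniq s, forall j, gm_quot_piece j (c j) & x = \sum_(j <- s) c j].
Proof.
have [u ->] := gm_pi_surj x; have [s [c [us hc eu]]] := gm_decomp u.
exists s, (fun j => gm_pi (c j)); split=> // [j|]; first by exists (c j).
by rewrite eu raddf_sum.
Qed.

Lemma gm_quot_indep (s : seq int) (c : int -> gm_quot_type) :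
  uniq s -> (forall j, gm_quot_piece j (c j)) -> \sum_(j <- s) c j = 0 ->
  forall j, j \in s -> c j = 0.
Proof.
move=> us hc s0 j js.
have /choice [z hz] : forall j, exists u, gm_piece M j u /\ c j = gm_pi u.
  by move=> i; have [u hu hcu] := hc i; exists u.
rewrite (hz j).2; apply/gm_pi_eq0.
apply: (gs_homog us (fun j => (hz j).1)) js.
apply/gm_pi_eq0; rewrite raddf_sum -[RHS]s0.
by apply: eq_bigr => i _; rewrite (hz i).2.
Qed.

Definition gm_quot : gradedModule k n :=
  GradedModule gm_quot_piece0 gm_quot_pieceB gm_quot_pieceZ
    gm_quot_decomp gm_quot_indep.

End SubQuotient.

(* H^i_m(M) is the cohomology of the Cech complex on x_1, ..., x_n, with
   C^i = \bigoplus_(#|A| = i) M_{x_A} and x_A = \prod_(l in A) x_l.  A cochain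
   is given by an exponent N and numerators c : it is the family of fractions
   c A / x_A ^ N.  As there are finitely many A, a common N always exists. *)
Section LocalCohomology.
Variables (k : fieldType) (n : nat) (M : gradedModule k n).

Definition xset (A : {set 'I_n}) : {mpoly k[n]} := \prod_(l in A) 'X_l.

(* u / x_A ^ N = v / x_A ^ N' in the localization M_{x_A} *)
Definition frac_eq (A : {set 'I_n}) (u : M) (N : nat) (v : M) (N' : nat) : Prop :=
  exists p : nat, xset A ^+ p *: (xset A ^+ N' *: u - xset A ^+ N *: v) = 0.

Definition cech_homog (j : int) (N : nat) (c : {set 'I_n} -> M) : Prop :=
  forall A : {set 'I_n}, gm_piece M (j + (N * #|A|)%N%:Z) (c A).

(* Numerators over x_B ^ N of the coboundary of c / x ^ N: the image of
   u / x_{B \ l} ^ N in M_{x_B} is (x_l ^ N u) / x_B ^ N. *)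
Definition cech_d (N : nat) (c : {set 'I_n} -> M) (B : {set 'I_n}) : M :=
  \sum_(l in B) (((-1) ^+ #|[set l' in B | (l' < l)%N]|) : {mpoly k[n]})
                  *: ('X_l ^+ N *: c (B :\ l)).

Definition cech_cocycle (i N : nat) (c : {set 'I_n} -> M) : Prop :=
  forall B : {set 'I_n}, #|B| = i.+1 -> frac_eq B (cech_d N c B) N 0 N.

Definition cech_coboundary (i : nat) (j : int) (N : nat) (c : {set 'I_n} -> M) :=
  exists (N' : nat) (b : {set 'I_n} -> M), cech_homog j N' b /\
    forall A : {set 'I_n}, #|A| = i -> frac_eq A (c A) N (cech_d N' b A) N'.

(* H^i_m(M)_j <> 0 *)
Definition lc_neq0 (i : nat) (j : int) : Prop :=
  exists (N : nat) (c : {set 'I_n} -> M),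
    [/\ cech_homog j N c, cech_cocycle i N c & ~ cech_coboundary i j N c].

Definition a_inv (i : nat) : extint :=
  extsup (fun x => exists2 j : int, lc_neq0 i j & x = EFin j).

Definition regularity : extint :=
  extsup (fun x => exists i : nat, x = adde (a_inv i) (EFin i%:Z)).

End LocalCohomology.

Section Koszul.
Variables (k : fieldType) (n r : nat) (d : 'I_r -> nat) (f : 'I_r -> {mpoly k[n]}).
Local Notation S := {mpoly k[n]}.

(* The exterior algebra of the free module with basis (e_l): x stands for
   \sum_A (x A) e_A with e_A = e_{l_1} /\ ... /\ e_{l_t}, A = {l_1 < ... < l_t}. *)
Definition ext := {ffun {set 'I_r} -> S^o}.
HB.instance Definition _ := GRing.Lmodule.on ext.

Definition homogz (e : int) (p : S) : Prop :=
  forall m, m \in msupp p -> (mdeg m)%:Z = e.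

Definition ext_deg (A : {set 'I_r}) : int := (\sum_(l in A) d l)%N%:Z.

Definition ext_piece (j : int) : set ext :=
  fun x => forall A, homogz (j - ext_deg A) (x A : S).

Lemma homogzE e p : homogz e p <-> forall m, (mdeg m)%:Z <> e -> p@_m = 0.
Proof.
split=> h m; first by move=> hm; apply/memN_msupp_eq0/negP => /h.
rewrite mcoeff_msupp => hm; apply/eqP/negPn/negP => /eqP /h.
exact/eqP.
Qed.

Lemma homogz0 e : homogz e 0.
Proof. by move=> m; rewrite msupp0. Qed.

Lemma homogzB e p q : homogz e p -> homogz e q -> homogz e (p - q).
Proof.
move=> /homogzE hp /homogzE hq; apply/homogzE => m hm.
by rewrite mcoeffB hp ?hq ?subr0.
Qed.

Lemma homogz_sum e (I : Type) (s : seq I) (P : pred I) (F : I -> S) :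
  (forall i, P i -> homogz e (F i)) -> homogz e (\sum_(i <- s | P i) F i).
Proof.
move=> h; elim/big_rec: _ => [|i p Pi hp]; first exact: homogz0.
rewrite -[p]opprK; apply: homogzB; first exact: h.
by rewrite -sub0r; apply: homogzB => //; apply: homogz0.
Qed.

Lemma homogzM (b : nat) e p q :
  p \is b.-homog -> homogz e q -> homogz (b%:Z + e) (p * q).
Proof.
move=> /dhomogP hp hq m /msuppM_le /allpairsP [[m1 m2] /= [h1 h2 ->]].
by rewrite mdegD PoszD (hq _ h2) (hp _ h1).
Qed.

Lemma ext_piece0 j : ext_piece j 0.
Proof. by move=> A; rewrite ffunE; apply: homogz0. Qed.

Lemma ext_pieceB j x y : ext_piece j x -> ext_piece j y -> ext_piece j (x - y).
Proof. by move=> hx hy A; rewrite !ffunE; apply: homogzB. Qed.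

Lemma ext_pieceZ (b : nat) j (p : S) x :
  p \is b.-homog -> ext_piece j x -> ext_piece (b%:Z + j) (p *: x).
Proof. by move=> hp hx A; rewrite ffunE -addrA; apply: homogzM. Qed.

Lemma ext_decomp (x : ext) : exists (s : seq int) (c : int -> ext),
  [/\ uniq s, forall j, ext_piece j (c j) & x = \sum_(j <- s) c j].
Proof.
pose s := undup (flatten [seq [seq (mdeg m)%:Z + ext_deg A | m <- msupp (x A : S)]
                         | A <- enum {set 'I_r}]).
pose c j : ext := [ffun A => \sum_(m <- msupp (x A : S)
   | (mdeg m)%:Z + ext_deg A == j) (x A : S)@_m *: 'X_[m]].
exists s, c; split=> [|j A|]; first exact: undup_uniq.
- rewrite ffunE; apply: homogz_sum => m /eqP <- m'.
  move/msuppZ_le; rewrite msuppX inE => /eqP ->; by rewrite addrK.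
- apply/ffunP => A; rewrite sum_ffunE [LHS](mpolyE (x A : S)).
  under [RHS]eq_bigr do rewrite ffunE.
  rewrite (exchange_big_dep predT) //=.
  apply: eq_big_seq => m hm; rewrite (big_rem ((mdeg m)%:Z + ext_deg A)) /=; last first.
    rewrite mem_undup; apply/flattenP.
    exists [seq (mdeg m)%:Z + ext_deg A | m <- msupp (x A : S)].
      by apply/mapP; exists A; rewrite ?mem_enum.
    by apply/mapP; exists m.
  rewrite eqxx big_seq_cond big1 ?addr0 // => j /andP [].
  by rewrite mem_rem_uniq ?undup_uniq // inE => /andP [/negbTE + _] /eqP e; rewrite e eqxx.
Qed.

Lemma ext_indep (s : seq int) (c : int -> ext) :
  uniq s -> (forall j, ext_piece j (c j)) -> \sum_(j <- s) c j = 0 ->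
  forall j, j \in s -> c j = 0.
Proof.
move=> us hc s0 j js; apply/ffunP => A; rewrite [RHS]ffunE; apply/mpolyP => m.
rewrite mcoeff0; have [e|/eqP ne] := eqVneq ((mdeg m)%:Z) (j - ext_deg A); last first.
  by move/homogzE: (hc j A); apply.
have /(congr1 (fun x : ext => (x A : S)@_m)) := s0.
rewrite sum_ffunE raddf_sum (big_rem j) //= ffunE mcoeff0 big_seq big1 ?addr0 //.
move=> i; rewrite mem_rem_uniq // inE => /andP [ij _].
move/homogzE: (hc i A); apply=> e'; move: ij; rewrite e in e'.
by move/addIr: e' => ->; rewrite eqxx.
Qed.

Definition ext_gm : gradedModule k n :=
  GradedModule ext_piece0 ext_pieceB ext_pieceZ ext_decomp ext_indep.

(* d e_A = \sum_(l in A) (-1) ^ #{l' in A | l' < l} f_l e_(A \ l), written on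
   the coordinates of x. *)
Definition koszul_d (x : ext) : ext :=
  [ffun B : {set 'I_r} => \sum_(l : 'I_r | l \notin B)
     (-1) ^+ #|[set l' in B | (l' < l)%N]| * f l * (x (l |: B) : S)].

Lemma koszul_d_is_linear : linear koszul_d.
Proof.
move=> p x y; apply/ffunP => B; rewrite !ffunE scaler_sumr -big_split /=.
apply: eq_bigr => l _; rewrite !ffunE mulrDr; congr (_ + _).
by rewrite /GRing.scale /= !mulrA; congr (_ * _); rewrite mulrC !mulrA.
Qed.
HB.instance Definition _ :=
  GRing.isLinear.Build S ext ext _ koszul_d koszul_d_is_linear.

(* [t] is an integer, so that cycles and homology vanish for t < 0. *)
Definition ext_in_position (t : int) (x : ext) : Prop :=
  forall A : {set 'I_r}, #|A|%:Z <> t -> x A = 0.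

Hypothesis f_homog : forall l, f l \is (d l).-homog.

Lemma koszul_d_piece j x : ext_piece j x -> ext_piece j (koszul_d x).
Proof.
move=> hx B; rewrite ffunE; apply: homogz_sum => l lB.
have -> : j - ext_deg B = (d l)%:Z + (j - ext_deg (l |: B)).
  rewrite /ext_deg big_setU1 //= PoszD opprD addrCA; congr (_ + _).
  by rewrite addrA subrr add0r.
apply: homogzM; last exact: hx.
rewrite -signr_odd; case: odd; rewrite ?expr0 ?expr1 ?mul1r //.
by rewrite mulN1r rpredN.
Qed.

Lemma ker_homog (phi : {linear ext -> ext}) :
  (forall j x, ext_piece j x -> ext_piece j (phi x)) ->
  forall (s : seq int) (c : int -> ext), uniq s ->
    (forall j, ext_piece j (c j)) -> phi (\sum_(j <- s) c j) = 0 ->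
    forall j, j \in s -> phi (c j) = 0.
Proof.
move=> hphi s c us hc; rewrite raddf_sum => s0 j js.
exact: (@ext_indep s (phi \o c) us (fun j => hphi _ _ (hc j)) s0).
Qed.

Lemma ext_in_position_homog t (s : seq int) (c : int -> ext) : uniq s ->
  (forall j, ext_piece j (c j)) -> ext_in_position t (\sum_(j <- s) c j) ->
  forall j, j \in s -> ext_in_position t (c j).
Proof.
move=> us hc h j js A hA.
pose c' j : ext := [ffun B => if B == A then c j B else 0].
have /(congr1 (fun x : ext => x A)) : c' j = 0.
  apply: (@ext_indep s) js => // [i B|].
    by rewrite ffunE; case: ifP => _; [apply: hc | apply: homogz0].
  apply/ffunP => B; rewrite sum_ffunE ffunE.
  have [->|/negbTE BA] := eqVneq B A.
    rewrite -[RHS](h A hA) sum_ffunE.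
    by apply: eq_bigr => i _; rewrite ffunE eqxx.
  by rewrite big1 // => i _; rewrite ffunE BA.
by rewrite !ffunE eqxx.
Qed.

Definition cycle_set (t : int) : set ext_gm :=
  fun x => ext_in_position t x /\ koszul_d x = 0.

Lemma cycle_set0 t : cycle_set t 0.
Proof. by split; [move=> A _; rewrite ffunE | rewrite raddf0]. Qed.

Lemma cycle_set_lin t (p : S) u v :
  cycle_set t u -> cycle_set t v -> cycle_set t (p *: u + v).
Proof.
move=> [hu du] [hv dv]; split.
  2: by rewrite [LHS](koszul_d_is_linear p u v) du dv scaler0 addr0.
by move=> A hA; rewrite !ffunE hu ?hv // scaler0 addr0.
Qed.

Lemma cycle_set_homog t (s : seq int) (c : int -> ext_gm) : uniq s ->
  (forall j, gm_piece ext_gm j (c j)) -> cycle_set t (\sum_(j <- s) c j) ->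
  forall j, j \in s -> cycle_set t (c j).
Proof.
move=> us hc [h1 h2] j js; split; first exact: ext_in_position_homog h1 _ js.
exact: (ker_homog koszul_d_piece us hc h2 js).
Qed.

Definition koszul_cycles (t : int) : gradedModule k n :=
  gm_sub (GradedSub (cycle_set0 t) (@cycle_set_lin t) (@cycle_set_homog t)).

Definition boundary_set (t : int) : set (koszul_cycles t) :=
  fun z => exists2 y : ext, ext_in_position (t + 1) y & val z = koszul_d y.

Lemma boundary_set0 t : boundary_set (0 : koszul_cycles t).
Proof. by exists 0; [move=> A _; rewrite ffunE | rewrite !raddf0]. Qed.

Lemma boundary_set_lin t (p : S) (u v : koszul_cycles t) :
  boundary_set u -> boundary_set v -> boundary_set (p *: u + v).
Proof.
move=> [y hy eu] [z hz ev]; exists (p *: y + z).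
  2: by rewrite koszul_d_is_linear -eu -ev.
by move=> A hA; rewrite !ffunE hy ?hz // scaler0 addr0.
Qed.

Lemma boundary_set_homog t (s : seq int) (c : int -> koszul_cycles t) : uniq s ->
  (forall j, gm_piece (koszul_cycles t) j (c j)) ->
  boundary_set (\sum_(j <- s) c j) -> forall j, j \in s -> boundary_set (c j).
Proof.
move=> us hc [y hy ey] j js.
have [s' [y_ [us' hy_ eqy]]] := ext_decomp y.
pose b i : ext := if i \in s' then y_ i else 0.
have hb i : ext_piece i (b i).
  by rewrite /b; case: ifP => // _; apply: ext_piece0.
exists (b j).
  rewrite /b; case: ifP => [js'|_]; last by move=> A _; rewrite ffunE.
  by apply: (ext_in_position_homog us' hy_) js'; rewrite -eqy.
pose a i : ext := if i \in s then val (c i) else 0.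
have ha i : ext_piece i (a i).
  by rewrite /a; case: ifP => // _; [apply: hc | apply: ext_piece0].
pose u := undup (s ++ s').
have su (q : seq int) (F : int -> ext) : uniq q -> {subset q <= u} ->
    \sum_(i <- u) (if i \in q then F i else 0) = \sum_(i <- q) F i.
  move=> uq qu; rewrite -big_mkcond -big_filter; apply: perm_big.
  apply: uniq_perm => //; first by rewrite filter_uniq ?undup_uniq.
  by move=> i; rewrite mem_filter; case: (boolP (i \in q)) => // /qu ->.
suff h : a j - koszul_d (b j) = 0.
  by move/eqP: h; rewrite subr_eq0 /a js => /eqP.
apply: (@ext_indep u (fun i => a i - koszul_d (b i))).
- exact: undup_uniq.
- by move=> i; apply: ext_pieceB => //; apply: koszul_d_piece.
- rewrite sumrB -raddf_sum su //; last first.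
    by move=> i hi; rewrite mem_undup mem_cat hi.
  rewrite su //; last by move=> i hi; rewrite mem_undup mem_cat hi orbT.
  by rewrite -eqy; apply/eqP; rewrite subr_eq0 -raddf_sum; apply/eqP; exact: ey.
- by rewrite mem_undup mem_cat js.
Qed.

Definition koszul_homology (t : int) : gradedModule k n :=
  gm_quot (GradedSub (boundary_set0 t) (@boundary_set_lin t)
                     (@boundary_set_homog t)).

End Koszul.

Section Ideals.
Variables (k : fieldType) (n : nat).
Local Notation S := {mpoly k[n]}.

Definition ideal_gen (r : nat) (f : 'I_r -> S) (A : {set 'I_r}) : set S :=
  fun p => exists c : 'I_r -> S, p = \sum_(l in A) c l * f l.

Definition min_generated (I : set S) (r : nat) (f : 'I_r -> S) : Prop :=
  I = ideal_gen f [set: 'I_r]%SET /\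
  forall A : {set 'I_r}, A \proper [set: 'I_r]%SET -> ideal_gen f A <> I.

Definition prime_ideal (P : set S) : Prop :=
  [/\ P 0, forall a u v, P u -> P v -> P (a * u + v), ~ P 1 &
      forall u v, P (u * v) -> P u \/ P v].

(* The Krull dimension of S/I: primes of S/I are primes of S containing I.
   It is -oo when I = S. *)
Definition krull_dim_quot (I : set S) : extint :=
  extsup (fun x => exists (e : nat) (P : nat -> set S), x = EFin e%:Z /\
    [/\ forall i, (i <= e)%N -> prime_ideal (P i),
        forall i, (i <= e)%N -> (I `<=` P i)%classic &
        forall i, (i < e)%N -> (P i `<` P i.+1)%classic]).

End Ideals.

(* Main.v *)
Require Import Defs.
From HB Require Import structures.
From mathcomp Require Import all_boot all_order all_algebra.
From mathcomp Require Import mpoly boolp classical_sets.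
From mathcomp Require Import -(notations) constructive_ereal.
From mathcomp Require Import zify ring finset.

(** The Koszul homology H_t is killed by I, so dim S/I <= 1 leaves only H^0 and H^1
   of it. Chasing the sequences 0 -> Z_(t+1) -> K_(t+1) -> B_t -> 0 and
   0 -> B_t -> Z_t -> H_t -> 0, where the free modules K_t only have H^n, shows that
   for 0 < p < n the module H^p(B_t) is built from H^0(H_(t-p+1)) and, if p > 1,
   H^1(H_(t-p+2)), and that H^(p+1)(Z_(t+1)) = H^p(B_t) for p < n - 1. This gives every term of the
   formula, except the contributions of H^n(Z_i) coming from K_i and of
   H^1(H_(i-n+1)), which lies in H^n(B_(i-1)). Both are controlled by the largest
   degree D of a basis element e_Q of K_i. Indeed, e_Q is a minimal generator of
   B_(i-1) because the f_l are minimal generators, so H^p(B_(i-1)) is nonzero in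
   degree D - p for some p <= n by Mumford's lemma; and H^n(B_(i-1)) vanishes in
   degrees >= D - n, since the socle element (x_1 ... x_n)^-1 e_Q of H^n(K_i) is
   eta d(e_l /\ e_Q) for some l not in Q (here i < r is used) and some class eta of
   H^n(S) with f_l eta = (x_1 ... x_n)^-1 and f_m eta = 0 for m in Q. Hence p < n, and
   both sides of the formula are at least D + 1. *)

Import Order.TTheory GRing.Theory Num.Theory.
Local Open Scope ring_scope.

Set Implicit Arguments.
Unset Strict Implicit.
Unset Printing Implicit Defensive.

(** * Koszul differentials *)

(** The shift j + 1 counts connecting maps: a class of H^0(H_(i-j)) enters H^1(B_(i-j)), climbs one
    cohomological degree with each K_t, and reaches H^(j+1)(Z_i); for j < n - 1 a class of
    H^1(H_(i-j)) reaches H^(j+2)(Z_i) in the same way. Only vanishing in a single degree is ever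
    needed, so no cohomology group or connecting map is formed: [lc_vanish] is transported along
    short exact sequences, and the two sides, which may a priori be infinite, are compared through
    their integer upper bounds. The bound on dim S/I is used without noetherian arguments. Were
    [kills_high] false for I, Zorn's lemma would give a homogeneous prime P over I for which it is
    still false, and two variables would extend P to a chain of primes P < Q < (x_1, ..., x_n). For
    this property to behave well along chains of ideals, it is witnessed by finitely many
    annihilators. The inequality n > 1, on which the vanishing of H^0 and H^1 of the cycles rests,
    follows from 1 < r by minimality of the generators. *)

Definition sg n (A : {set 'I_n}) (l : 'I_n) : nat :=
  #|[set l' in A | (l' < l)%N]|.

Lemma sg_setU1 n (A : {set 'I_n}) l m :
  m \notin A -> sg (m |: A) l = ((m < l)%N + sg A l)%N.
Proof.
move=> mA; rewrite /sg; case: (boolP (m < l)%N) => ml.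
  rewrite -[true : nat]/1%N (_ : [set _ in _ | _] = m |: [set l' in A | (l' < l)%N]).
    by rewrite cardsU1 inE (negbTE mA).
  by apply/setP => x; rewrite !inE; case: eqVneq => // ->; rewrite ml.
rewrite add0n; apply/esym/eq_card => x; rewrite !inE.
by case: eqVneq => // ->; rewrite (negbTE ml) andbF.
Qed.

Lemma sg_setU1_id n (A : {set 'I_n}) l : sg (l |: A) l = sg A l.
Proof.
case: (boolP (l \in A)) => lA; first by rewrite (setUidPr _) ?sub1set.
by rewrite sg_setU1 // ltnn.
Qed.

Lemma sg_setD1 n (A : {set 'I_n}) l m :
  m \in A -> sg A l = ((m < l)%N + sg (A :\ m) l)%N.
Proof. by move=> mA; rewrite -{1}(setD1K mA) sg_setU1 // setD11. Qed.

Lemma sg_setD1_id n (A : {set 'I_n}) l : sg (A :\ l) l = sg A l.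
Proof.
case: (boolP (l \in A)) => lA; first by rewrite [RHS](@sg_setD1 _ A l l) // ltnn.
congr sg; apply/setP => x; rewrite !inE; case: eqVneq => //= ->.
by rewrite (negbTE lA).
Qed.

Lemma sign_ltn_swap (R : pzRingType) n (l m : 'I_n) : l != m ->
  (-1) ^+ (l < m)%N = - (-1) ^+ (m < l)%N :> R.
Proof.
move=> /eqP lm; case: ltngtP => [||e]; rewrite ?expr0 ?expr1 ?opprK //.
by case: lm; apply: val_inj.
Qed.

(** The terms (l, m) and (m, l) cancel. The sum is split along l < m rather than doubled, since 2
    may be zero in [V]. *)
Lemma big_antisym n (V : zmodType) (P : rel 'I_n) (F : 'I_n -> 'I_n -> V) :
  ssrbool.symmetric P -> irreflexive P -> (forall l m, P l m -> F m l = - F l m) ->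
  \sum_l \sum_(m | P l m) F l m = 0.
Proof.
move=> Ps Pi hF.
under eq_bigr => l _ do rewrite (bigID (fun m : 'I_n => l < m)%N) /=.
rewrite big_split /= [X in _ + X](exchange_big_dep predT) //= -big_split /=.
rewrite big1 // => l _.
rewrite [X in X + _](eq_bigr (fun m => - F m l)); last first.
  by move=> m /andP[plm _]; rewrite hF // Ps.
rewrite [X in _ + X](eq_bigl (fun m => P l m && (l < m)%N)); last first.
  move=> m; rewrite Ps -leqNgt leq_eqVlt; case: (boolP (P l m)) => //= plm.
  case: eqP => // /val_inj e; by move: plm; rewrite e Pi.
by rewrite sumrN addNr.
Qed.

Section Koszul.
Variables (R : comNzRingType) (V : lmodType R) (n : nat) (y : 'I_n -> R).
Implicit Types (c : {set 'I_n} -> V) (A B Q : {set 'I_n}).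

(** For y_l = x_l^N this is the Cech differential on numerators of exponent N; its companion
    [kosz_down] with y = f is the Koszul differential. Coefficients in a module allow both to act on
    one double complex. *)
Definition kosz_up c B : V :=
  \sum_(l in B) (-1) ^+ sg B l *: (y l *: c (B :\ l)).

Definition kosz_down c Q : V :=
  \sum_(l | l \notin Q) (-1) ^+ sg Q l *: (y l *: c (l |: Q)).

Lemma kosz_up_up c B : kosz_up (kosz_up c) B = 0.
Proof.
rewrite /kosz_up big_mkcond /=.
pose P := [rel l m : 'I_n | [&& l != m, l \in B & m \in B]].
pose F l m := ((-1) ^+ (sg B l + sg (B :\ l) m) * (y l * y m)) *: c (B :\ l :\ m).
rewrite -[RHS](@big_antisym n V P F); last first.
- move=> l m /and3P[/= lm lB mB]; rewrite /F -scaleNr (mulrC (y m)) -mulNr.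
  have -> : B :\ m :\ l = B :\ l :\ m by rewrite setDDl setUC -setDDl.
  congr (_ * _ *: _); rewrite (sg_setD1 l mB) (sg_setD1 m lB) !exprD.
  rewrite (sign_ltn_swap R lm); set a := _ ^+ _; set b := _ ^+ sg _ _.
  by move: (_ ^+ sg (B :\ m) l) => e; ring.
- by move=> l; rewrite /= eqxx.
- by move=> l m /=; rewrite eq_sym [(m \in _) && _]andbC.
apply: eq_bigr => l _; case: ifPn => [lB|/negbTE lB]; last first.
  by rewrite big_pred0 // => m /=; rewrite lB andbF.
rewrite !scaler_sumr; apply: eq_big => [m|m _].
  by rewrite /P /= lB !inE eq_sym.
by rewrite !scalerA /F exprD -!mulrA; congr (_ * _ *: _); rewrite !mulrA [y l * _]mulrC.
Qed.

Lemma kosz_down_down c Q : kosz_down (kosz_down c) Q = 0.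
Proof.
rewrite /kosz_down big_mkcond /=.
pose P := [rel l m : 'I_n | [&& l != m, l \notin Q & m \notin Q]].
pose F l m := ((-1) ^+ (sg Q l + sg (l |: Q) m) * (y l * y m)) *: c (m |: (l |: Q)).
rewrite -[RHS](@big_antisym n V P F); last first.
- move=> l m /and3P[/= lm lQ mQ]; rewrite /F -scaleNr (mulrC (y m)) -mulNr setUCA.
  congr (_ * _ *: _); rewrite !sg_setU1 // !exprD (sign_ltn_swap R lm).
  move: ((-1) ^+ _) ((-1) ^+ _) ((-1) ^+ _) => a b e; ring.
- by move=> l; rewrite /= eqxx.
- by move=> l m /=; rewrite eq_sym [(m \notin _) && _]andbC.
apply: eq_bigr => l _; case: ifPn => [lQ|/negbTE lQ]; last first.
  by rewrite big_pred0 // => m /=; rewrite lQ andbF.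
rewrite !scaler_sumr; apply: eq_big => [m|m _].
  by rewrite /P /= lQ !inE negb_or eq_sym.
by rewrite !scalerA /F exprD -!mulrA; congr (_ * _ *: _); rewrite !mulrA [y l * _]mulrC.
Qed.

(* A contracting homotopy for the variable [l], twisted by an additive map that
   commutes with all the other coefficients. *)
Definition kosz_contr (l : 'I_n) (pi : V -> V) c A : V :=
  if l \in A then 0 else (-1) ^+ sg A l *: pi (c (l |: A)).

Section Contraction.
Variables (l : 'I_n) (pi : {additive V -> V}).
Hypothesis pi_scale : forall m v, m != l -> pi (y m *: v) = y m *: pi v.

(** The indices m <> l cancel between the two summands because [pi] commutes with y_m; only the
    index [l] survives. *)
Lemma kosz_contr_notin c B : l \notin B ->
  kosz_up (kosz_contr l pi c) B + kosz_contr l pi (kosz_up c) B =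
  pi (y l *: c B).
Proof.
move=> lB; rewrite /kosz_contr (negbTE lB) /kosz_up big_setU1 //=.
have pis b v : pi ((-1) ^+ b *: v) = (-1) ^+ b *: pi v.
  by rewrite -signr_odd !scaler_sign; case: odd => //; rewrite raddfN.
rewrite raddfD /= pis setU1K // sg_setU1_id scalerDr scalerA -signr_odd -expr2 sqrr_sign scale1r.
rewrite addrCA -[RHS]addr0; congr (_ + _).
rewrite raddf_sum scaler_sumr -big_split big1 //= => m mB.
have ml : m != l by apply: contraNneq lB => <-.
rewrite !inE eq_sym (negbTE ml) (negbTE lB) /= pis pi_scale //.
rewrite !scalerA -!scalerA.
have -> : (l |: B) :\ m = l |: (B :\ m).
  by apply/setP => x; rewrite !inE; case: eqVneq => //= ->; rewrite (negbTE ml).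
rewrite !scalerA -scalerDl [X in X *: _](_ : _ = 0) ?scale0r // signr_odd.
rewrite sg_setU1 // (sg_setD1 l mB) !exprD (sign_ltn_swap R ml).
rewrite !mulNr -!mulrA; apply/eqP; rewrite subr_eq0; apply/eqP.
by case: (l < m)%N; rewrite ?expr0 ?expr1; move: (_ ^+ _) (_ ^+ _) => a b; ring.
Qed.

(** [kosz_contr] is zero on sets containing [l], so the summand of [l] is the only one left. *)
Lemma kosz_contr_in c B : l \in B ->
  kosz_up (kosz_contr l pi c) B = y l *: pi (c B).
Proof.
move=> lB; rewrite /kosz_up (bigD1 l) //= big1 ?addr0.
  rewrite /kosz_contr setD11 setD1K // sg_setD1_id !scalerA mulrAC -expr2.
  by rewrite -signr_odd sqrr_sign mul1r.
by move=> m /andP[mB ml]; rewrite /kosz_contr !inE eq_sym ml lB !scaler0.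
Qed.

End Contraction.

Definition kosz_wedge (l : 'I_n) c A : V :=
  if l \in A then (-1) ^+ sg A l *: c (A :\ l) else 0.

(** Exterior multiplication by e_l is a homotopy from multiplication by y_l to zero; hence y_l kills
    the homology of [kosz_down]. *)
Lemma kosz_wedgeP l c B :
  kosz_down (kosz_wedge l c) B + kosz_wedge l (kosz_down c) B = y l *: c B.
Proof.
rewrite /kosz_wedge; case: ifPn => lB.
  have lD : l \notin B :\ l by rewrite setD11.
  rewrite /kosz_down scaler_sumr [X in _ + X](bigD1 l) ?setD11 //= setD1K //.
  rewrite sg_setD1_id scalerA -signr_odd -expr2 sqrr_sign scale1r.
  rewrite addrCA -[RHS]addr0; congr (_ + _).
  rewrite [X in _ + X](eq_bigl (fun m => m \notin B)); last first.
    move=> m; rewrite !inE negb_and negbK andb_orl andbN /=.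
    by case: eqVneq => [->|]; rewrite ?lB ?andbT.
  rewrite -big_split big1 //= => m mB.
  have ml : m != l by apply: contraNneq mB => ->.
  rewrite !inE lB orbT !scalerA.
  have -> : (m |: B) :\ l = m |: (B :\ l).
    by apply/setP => x; rewrite !inE; case: eqVneq => //= ->; rewrite eq_sym (negbTE ml).
  rewrite -scalerDl [X in X *: _](_ : _ = 0) ?scale0r //.
  rewrite sg_setU1 // (sg_setD1 m lB) !exprD (sign_ltn_swap R ml) signr_odd.
  by case: (l < m)%N; rewrite ?expr0 ?expr1; move: (_ ^+ _) (_ ^+ _) => a b; ring.
rewrite addr0 {1}/kosz_down (bigD1 l) //= big1 ?addr0.
  by rewrite setU11 setU1K // sg_setU1_id !scalerA mulrAC -expr2 -signr_odd sqrr_sign mul1r.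
by move=> m /andP[mB ml]; rewrite !inE eq_sym (negbTE ml) (negbTE lB) !scaler0.
Qed.

End Koszul.

(** * Cech cohomology and exact sequences *)

Section GradedModule.
Variables (k : fieldType) (n : nat) (M : gradedModule k n).
Implicit Types (u v : M) (c : {set 'I_n} -> M) (A B S : {set 'I_n}).

Lemma gm_pieceN j u : gm_piece M j u -> gm_piece M j (- u).
Proof. by move=> hu; rewrite -sub0r; apply: gm_pieceB => //; apply: gm_piece0. Qed.

Lemma gm_pieceD j u v : gm_piece M j u -> gm_piece M j v -> gm_piece M j (u + v).
Proof. by move=> hu hv; rewrite -[v]opprK; apply: gm_pieceB => //; apply: gm_pieceN. Qed.

Lemma gm_piece_sum j (T : Type) (s : seq T) (P : pred T) (F : T -> M) :
  (forall i, P i -> gm_piece M j (F i)) -> gm_piece M j (\sum_(i <- s | P i) F i).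
Proof.
move=> hF; elim/big_rec: _ => [|i u Pi hu]; first exact: gm_piece0.
by apply: gm_pieceD => //; apply: hF.
Qed.

Lemma gm_piece_sign j (b : nat) u :
  gm_piece M j u -> gm_piece M j ((-1) ^+ b *: u).
Proof.
by move=> hu; rewrite -signr_odd scaler_sign; case: odd => //; apply: gm_pieceN.
Qed.

Lemma gm_pieceZ_eq (d : nat) i j (p : {mpoly k[n]}) u :
  p \is d.-homog -> gm_piece M i u -> j = d%:Z + i -> gm_piece M j (p *: u).
Proof. by move=> hp hu ->; apply: gm_pieceZ. Qed.

Lemma xset_homog (A : {set 'I_n}) q : xset k A ^+ q \is (q * #|A|).-homog.
Proof.
rewrite mulnC; apply: dhomogMn; rewrite /xset -sum1_card.
elim/big_ind2: _ => [|p d q' e hp hq|l _]; first exact: dhomog1.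
  exact: dhomogM.
by rewrite dhomogX /= mdeg1.
Qed.

Lemma XE_homog (l : 'I_n) N : ('X_l ^+ N : {mpoly k[n]}) \is N.-homog.
Proof. by rewrite -{2}[N]mul1n; apply: dhomogMn; rewrite dhomogX /= mdeg1. Qed.

Lemma xset_setD1 (B : {set 'I_n}) l : l \in B -> xset k B = 'X_l * xset k (B :\ l).
Proof. by move=> lB; rewrite /xset (big_setD1 l). Qed.

Lemma xset_exp_setD1 (B : {set 'I_n}) l q : l \in B ->
  xset k B ^+ q = 'X_l ^+ q * xset k (B :\ l) ^+ q.
Proof. by move=> lB; rewrite (xset_setD1 lB) exprMn. Qed.

(** The same fractions over the larger denominators x_A^(N+q): the transition map of the colimit
    over N. *)
Definition cech_push q c : {set 'I_n} -> M := fun A => xset k A ^+ q *: c A.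

Lemma cech_push_homog j N q c :
  cech_homog j N c -> cech_homog j (N + q) (cech_push q c).
Proof. by move=> hc A; apply: gm_pieceZ_eq (xset_homog _ _) (hc A) _; lia. Qed.

Lemma cech_d_push N q c B :
  cech_d (N + q) (cech_push q c) B = xset k B ^+ q *: cech_d N c B.
Proof.
rewrite /cech_d scaler_sumr; apply: eq_bigr => l lB.
rewrite !scalerA (xset_exp_setD1 q lB) exprD; congr (_ *: _); ring.
Qed.

Lemma cech_d_up N c : cech_d N c = kosz_up (fun l => 'X_l ^+ N) c.
Proof. by []. Qed.

Lemma cech_dd N c B : cech_d N (cech_d N c) B = 0.
Proof. exact: kosz_up_up. Qed.

Lemma cech_d_homog j N c : cech_homog j N c -> cech_homog j N (cech_d N c).
Proof.
move=> hc B; apply: gm_piece_sum => l lB; apply: gm_piece_sign.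
by apply: gm_pieceZ_eq (XE_homog l N) (hc _) _; rewrite (cardsD1 l B) lB; lia.
Qed.

Lemma eq_cech_d N p c (c' : {set 'I_n} -> M) B : #|B| = p.+1 ->
  (forall A : {set 'I_n}, #|A| = p -> c A = c' A) -> cech_d N c B = cech_d N c' B.
Proof.
move=> hB h; apply: eq_bigr => l lB; rewrite h //.
by move: hB; rewrite (cardsD1 l B) lB => -[].
Qed.

Lemma eq_cech_d0 N c (c' : {set 'I_n} -> M) B : #|B| = 0%N -> cech_d N c B = cech_d N c' B.
Proof. by move/cards0_eq ->; rewrite /cech_d !big_set0. Qed.

Lemma cech_dB N c (c' : {set 'I_n} -> M) B :
  cech_d N (fun A => c A - c' A) B = cech_d N c B - cech_d N c' B.
Proof. by rewrite /cech_d -sumrB; apply: eq_bigr => l lB; rewrite !scalerBr. Qed.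

Lemma cech_dD N c (c' : {set 'I_n} -> M) B :
  cech_d N (fun A => c A + c' A) B = cech_d N c B + cech_d N c' B.
Proof. by rewrite /cech_d -big_split; apply: eq_bigr => l lB; rewrite !scalerDr. Qed.

(* H^p_m(M)_j = 0, read off the presentation of the Cech complex as the colimit
   over N of the Koszul cochain complexes on x_1^N, ..., x_n^N: no fraction is
   involved any more. *)
Definition lc_vanish p j := forall N c, cech_homog j N c ->
  (forall B : {set 'I_n}, #|B| = p.+1 -> cech_d N c B = 0) ->
  exists q b, cech_homog j (N + q) b /\
    forall A : {set 'I_n}, #|A| = p -> cech_push q c A = cech_d (N + q) b A.

Lemma exists_common_bound (T : finType) (P : T -> nat -> Prop) :
  (forall x, exists p, P x p) -> (forall x p q, P x p -> P x (p + q)%N) ->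
  exists p, forall x, P x p.
Proof.
move=> /choice[g hg] hP; exists (\max_x g x) => x.
by rewrite -(subnKC (leq_bigmax x)); apply: hP.
Qed.

(** Denominators are cleared: equal fractions have equal numerators after multiplication by a power
    of x_A, and as there are finitely many A one power serves them all. *)
Lemma lc_neq0P p j : lc_neq0 M p j <-> ~ lc_vanish p j.
Proof.
split=> [[N [c [hc cyc nbd]]] van|nvan].
  have [| |P hP] := @exists_common_bound {set 'I_n}
     (fun B p' => #|B| = p.+1 -> xset k B ^+ p' *: cech_d N c B = 0).
  - move=> B; case: (eqVneq #|B| p.+1) => [/cyc[q]|/eqP nB]; last by exists 0%N.
    rewrite scaler0 subr0 scalerA -exprD => h; exists (q + N)%N => _; exact: h.
  - by move=> B a q h hB; rewrite addnC exprD -scalerA h ?scaler0.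
  have [B hB|q [b [hb e]]] := van _ _ (@cech_push_homog j N P c hc).
    by rewrite cech_d_push hP.
  apply: nbd; exists (N + P + q)%N, b; split=> // A hA; exists 0%N.
  rewrite scale1r -e // /cech_push !scalerA -!exprD.
  by rewrite addnAC subrr.
apply: contrapT => nlc; apply: nvan => N c hc cyc.
have cbd : cech_coboundary p j N c.
  apply: contrapT => nbd; apply: nlc; exists N, c; split=> // B hB.
  by exists 0%N; rewrite cyc // !scaler0 subr0 scaler0.
case: cbd => N' [b [hb e]].
have [| |P hP] := @exists_common_bound {set 'I_n}
   (fun A p' => #|A| = p -> xset k A ^+ p' *: (xset k A ^+ N' *: c A) =
                          xset k A ^+ p' *: (xset k A ^+ N *: cech_d N' b A)).
- move=> B; case: (eqVneq #|B| p) => [/e[q h]|/eqP nB]; last by exists 0%N.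
  by exists q => _; apply/eqP; rewrite -subr_eq0 -scalerBr h.
- by move=> B a q h hB; rewrite addnC exprD -!scalerA h.
(* Both cochains are brought to the exponent N + P + N'; P absorbs the power of x_A allowed by
   [frac_eq]. *)
exists (P + N')%N, (cech_push (P + N) b).
have -> : (N + (P + N') = N' + (P + N))%N by lia.
split; first exact: cech_push_homog.
by move=> A hA; rewrite cech_d_push /cech_push !exprD -!scalerA hP.
Qed.

Lemma lc_vanish_gt p j : (n < p)%N -> lc_vanish p j.
Proof.
move=> np N c hc _; exists 0%N, (cech_push 0 c); split; first exact: cech_push_homog.
by move=> A hA; move: (max_card (mem A)); rewrite hA card_ord leqNgt np.
Qed.

End GradedModule.
Arguments lc_vanish {k n} M p j.

Lemma cech_d_linear (k : fieldType) n (A B : gradedModule k n) (f : {linear A -> B}) N c B' :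
  f (cech_d N c B') = cech_d N (f \o c) B'.
Proof. by rewrite /cech_d linear_sum; apply: eq_bigr => l _; rewrite !(linearZ_LR f). Qed.

(** Exactness in the middle and surjectivity are stated degree by degree, with homogeneous lifts,
    because cochains are homogeneous. *)
Record graded_ses (k : fieldType) n (A B C : gradedModule k n)
    (f : {linear A -> B}) (g : {linear B -> C}) : Prop := GradedSes {
  ses_f_piece : forall j u, gm_piece A j u -> gm_piece B j (f u);
  ses_g_piece : forall j v, gm_piece B j v -> gm_piece C j (g v);
  ses_f_inj : forall u, f u = 0 -> u = 0;
  ses_gf : forall u, g (f u) = 0;
  ses_exact : forall j v, gm_piece B j v -> g v = 0 ->
    exists u, gm_piece A j u /\ f u = v;
  ses_surj : forall j w, gm_piece C j w -> exists v, gm_piece B j v /\ g v = w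
}.

Section LongExact.
Variables (k : fieldType) (n : nat) (A B C : gradedModule k n).
Variables (f : {linear A -> B}) (g : {linear B -> C}).
Hypothesis ses : graded_ses f g.
Implicit Types S : {set 'I_n}.

Lemma ses_cech_lift j N (c : {set 'I_n} -> C) : cech_homog j N c ->
  exists b : {set 'I_n} -> B, cech_homog j N b /\ forall S, g (b S) = c S.
Proof.
move=> hc; have /choice[b hb] : forall S, exists v, 
    gm_piece B (j + (N * #|S|)%N%:Z) v /\ g v = c S.
  by move=> S; apply: (ses_surj ses).
by exists b; split=> S; case: (hb S).
Qed.

Lemma ses_cech_ker j N p (b : {set 'I_n} -> B) : cech_homog j N b ->
  (forall S : {set 'I_n}, #|S| = p -> g (b S) = 0) ->
  exists a : {set 'I_n} -> A, cech_homog j N a /\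
    forall S : {set 'I_n}, #|S| = p -> f (a S) = b S.
Proof.
move=> hb gb; have /choice[a ha] : forall S, exists u,
    gm_piece A (j + (N * #|S|)%N%:Z) u /\ (#|S| = p -> f u = b S).
  move=> S; case: (eqVneq #|S| p) => [e|/eqP ne].
    by have [u [hu fu]] := ses_exact ses (hb S) (gb S e); exists u.
  by exists 0; split=> //; apply: gm_piece0.
by exists a; split=> S; case: (ha S).
Qed.

Lemma cech_comp_push (M M' : gradedModule k n) (h : {linear M -> M'}) q
  (c : {set 'I_n} -> M) S : h (cech_push q c S) = cech_push q (h \o c) S.
Proof. by rewrite /cech_push linearZ. Qed.

Lemma cech_comp_homog (M M' : gradedModule k n) (h : {linear M -> M'}) j N c :
  (forall j u, gm_piece M j u -> gm_piece M' j (h u)) ->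
  cech_homog j N c -> cech_homog j N (h \o c).
Proof. by move=> hh hc S; apply: hh. Qed.

(** Lift a primitive of the image in C and subtract its coboundary: the remaining cocycle comes from
    A. Each use of vanishing raises the exponent, so earlier data are pushed along. *)
Lemma lc_vanish_mid p j : lc_vanish A p j -> lc_vanish C p j -> lc_vanish B p j.
Proof.
move=> vA vC N c hc cyc.
have [S hS|q [b [hb e]]] := vC N (g \o c) (cech_comp_homog (ses_g_piece ses) hc).
  by rewrite -cech_d_linear cyc ?raddf0.
have [b' [hb' eb']] := ses_cech_lift hb.
have [||a [ha ea]] := @ses_cech_ker j (N + q) p
    (fun S => cech_push q c S - cech_d (N + q) b' S) _ _.
- by move=> S; apply: gm_pieceB; [apply: cech_push_homog | apply: cech_d_homog].
- move=> S hS; rewrite raddfB /= cech_comp_push cech_d_linear e //.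
  by rewrite (_ : g \o b' = b) ?subrr //; apply/funext.
have [S hS|q' [a' [ha' ea']]] := vA _ _ ha.
  apply: (ses_f_inj ses); rewrite cech_d_linear.
  rewrite (@eq_cech_d _ _ _ _ p _ (fun S => cech_push q c S - cech_d (N + q) b' S)) //.
  by rewrite cech_dB cech_dd cech_d_push cyc // scaler0 subr0.
exists (q + q')%N, (fun S => f (a' S) + cech_push q' b' S); rewrite addnA; split.
  move=> S; apply: gm_pieceD; first by apply: (ses_f_piece ses); apply: ha'.
  exact: cech_push_homog.
move=> S hS; rewrite cech_dD cech_d_push -[X in X + _](cech_d_linear f) -ea' //.
rewrite /cech_push linearZ /= ea // -scalerDr subrK /cech_push scalerA.
by rewrite -exprD addnC.
Qed.

(** The coboundary of a lift to B is a cocycle of A, as for the connecting map; a primitive in A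
    corrects the lift to a cocycle of B. *)
Lemma lc_vanish_right p j :
  lc_vanish B p j -> lc_vanish A p.+1 j -> lc_vanish C p j.
Proof.
move=> vB vA N c hc cyc.
have [b [hb eb]] := ses_cech_lift hc.
have [||a [ha ea]] := @ses_cech_ker j N p.+1 (cech_d N b) _ _.
- exact: cech_d_homog.
- by move=> S hS; rewrite cech_d_linear (_ : g \o b = c) ?cyc //; apply/funext.
have [S hS|q [a' [ha' ea']]] := vA _ _ ha.
  apply: (ses_f_inj ses); rewrite cech_d_linear.
  by rewrite (@eq_cech_d _ _ _ _ p.+1 _ (cech_d N b)) // cech_dd.
have [||q' [b' [hb' eb']]] := vB (N + q)%N (fun S => cech_push q b S - f (a' S)).
- move=> S; apply: gm_pieceB; first exact: cech_push_homog.
  by apply: (ses_f_piece ses); apply: ha'.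
- move=> S hS; rewrite cech_dB cech_d_push -[X in _ - X](cech_d_linear f).
  by rewrite -ea' // /cech_push linearZ /= ea // subrr.
exists (q + q')%N, (g \o b'); rewrite addnA; split.
  exact: (cech_comp_homog (ses_g_piece ses)).
move=> S hS; rewrite -cech_d_linear -eb' // cech_comp_push /cech_push /= raddfB /=.
by rewrite (ses_gf ses) subr0 linearZ /= eb scalerA -exprD addnC.
Qed.

(** A primitive in B of a cocycle of A maps to a cocycle of C. Once this is a coboundary,
    subtracting the coboundary of a lift moves the primitive into A. *)
Lemma lc_vanish_left p j :
  lc_vanish C p j -> lc_vanish B p.+1 j -> lc_vanish A p.+1 j.
Proof.
move=> vC vB N a ha cyc.
have [S hS|q [b [hb eb]]] := vB N (f \o a) (cech_comp_homog (ses_f_piece ses) ha).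
  by rewrite -cech_d_linear cyc ?raddf0.
have [S hS|q' [c [hc ec]]] := vC _ _ (cech_comp_homog (ses_g_piece ses) hb).
  by rewrite -cech_d_linear -eb // -cech_comp_push (ses_gf ses).
have [c' [hc' ec']] := ses_cech_lift hc.
have [||a' [ha' ea']] := @ses_cech_ker j (N + q + q')%N p
   (fun S => cech_push q' b S - cech_d (N + q + q') c' S) _ _.
- by move=> S; apply: gm_pieceB; [apply: cech_push_homog | apply: cech_d_homog].
- move=> S hS; rewrite raddfB /= cech_comp_push cech_d_linear ec //.
  by rewrite (_ : g \o c' = c) ?subrr //; apply/funext.
exists (q + q')%N, a'; rewrite addnA; split=> // S hS.
apply/eqP; rewrite -subr_eq0; apply/eqP/(ses_f_inj ses).
rewrite raddfB /= cech_d_linear.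
rewrite (@eq_cech_d _ _ _ _ p _ (fun S => cech_push q' b S - cech_d (N + q + q') c' S)) //.
rewrite cech_dB cech_dd subr0 cech_d_push -eb // cech_comp_push /cech_push.
by rewrite scalerA -exprD addnC subrr.
Qed.

(** Left exactness of H^0: coboundaries at the empty set are empty sums, so vanishing says that a
    push of the cochain is zero. *)
Lemma lc_vanish_left0 j : lc_vanish B 0 j -> lc_vanish A 0 j.
Proof.
move=> vB N a ha cyc.
have [S hS|q [b [hb eb]]] := vB N (f \o a) (cech_comp_homog (ses_f_piece ses) ha).
  by rewrite -cech_d_linear cyc ?raddf0.
exists q, (cech_push q a); split; first exact: cech_push_homog.
move=> S hS; apply/eqP; rewrite -subr_eq0; apply/eqP/(ses_f_inj ses).
rewrite raddfB /= cech_comp_push eb // cech_d_linear.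
by rewrite (@eq_cech_d0 _ _ _ _ b (f \o cech_push q a)) // subrr.
Qed.

End LongExact.

(** * Cohomology of the polynomial ring *)

Section FreeModule.
Variables (k : fieldType) (n : nat).
Local Notation S := {mpoly k[n]}.

(** Division by x_l^N that drops the monomials it does not divide: an additive left inverse of
    multiplication by x_l^N commuting with the other x_m^N, as [kosz_contr] requires. *)
Definition Xquo (l : 'I_n) (N : nat) (g : S^o) : S^o :=
  \sum_(m <- msupp (g : S) | (N <= m l)%N) (g : S)@_m *: 'X_[m - (U_(l) *+ N)].

Lemma Xquo_coef l N g m : (Xquo l N g : S)@_m = (g : S)@_(m + U_(l) *+ N).
Proof.
have mUl (m' : 'X_{1..n}) : (m' + U_(l) *+ N)%MM l = (m' l + N)%N.
  by rewrite mnmDE mulmnE mnm1E eqxx mul1n.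
have e (m' : 'X_{1..n}) : (N <= m' l)%N -> ((m' - U_(l) *+ N)%MM == m) = (m' == (m + U_(l) *+ N)%MM).
  move=> h; apply/eqP/eqP => [<-|->]; last by rewrite addmK.
  rewrite submK //; apply/mnm_lepP => i; rewrite mulmnE mnm1E.
  by case: eqVneq => [<-|]; rewrite ?mul1n ?mul0n.
rewrite /Xquo raddf_sum /=.
under eq_bigr => m' h do rewrite mcoeffZ mcoeffX e //.
case: (boolP ((m + U_(l) *+ N)%MM \in msupp (g : S))) => h.
  rewrite (big_rem _ h) /= mUl leq_addl eqxx mulr1 big_seq_cond big1 ?addr0 //.
  move=> m' /andP[]; rewrite mem_rem_uniq ?msupp_uniq // inE => /andP[/negbTE -> _] _.
  by rewrite mulr0.
rewrite (memN_msupp_eq0 h) big_seq_cond big1 // => m' /andP[hm' _].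
by case: eqVneq => [e'|]; rewrite ?mulr0 //; move: h; rewrite -e' hm'.
Qed.

Lemma Xquo_is_additive l N : zmod_morphism (Xquo l N).
Proof.
move=> g h; apply/mpolyP => m.
by rewrite mcoeffB !Xquo_coef mcoeffB.
Qed.
HB.instance Definition _ l N :=
  GRing.isZmodMorphism.Build S^o S^o (Xquo l N) (Xquo_is_additive l N).

Lemma mcoeffXnM (g : S) l N m :
  ('X_l ^+ N * g)@_m = if (N <= m l)%N then g@_(m - U_(l) *+ N) else 0.
Proof.
rewrite mpolyXn mulrC; case: ifPn => h.
  rewrite -{1}(@submK _ (U_(l) *+ N) m) 1?addmC ?mcoeffMX //.
  apply/mnm_lepP => i; rewrite mulmnE mnm1E.
  by case: eqVneq => [<-|]; rewrite ?mul1n ?mul0n.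
apply/memN_msupp_eq0; apply: contra h => /msuppM_le/allpairsP[[m1 m2] /= [_ + ->]].
by rewrite msuppX inE => /eqP ->; rewrite mnmDE mulmnE mnm1E eqxx mul1n leq_addl.
Qed.

Lemma XquoM l N m g : m != l -> Xquo l N ('X_m ^+ N *: g) = 'X_m ^+ N *: Xquo l N g.
Proof.
move=> ml; apply/mpolyP => m'; rewrite Xquo_coef !mcoeffXnM Xquo_coef.
have -> : (m' + U_(l) *+ N)%MM m = m' m.
  by rewrite mnmDE mulmnE mnm1E eq_sym (negbTE ml) mul0n addn0.
case: ifPn => // h; congr (_ @_ _); apply/mnmP => i.
rewrite !(mnmBE, mnmDE, mulmnE, mnm1E).
by case: (eqVneq m i) => [<-|]; case: (eqVneq l) => [e|] //; lia.
Qed.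

Lemma XquoK l N g : Xquo l N ('X_l ^+ N *: g) = g.
Proof.
apply/mpolyP => m'; rewrite Xquo_coef mcoeffXnM addmK.
by rewrite mnmDE mulmnE mnm1E eqxx mul1n leq_addl.
Qed.

Lemma Xquo_homogz l N (e : int) g : homogz e g -> homogz (e - N%:Z) (Xquo l N g).
Proof.
move=> hg m; rewrite mcoeff_msupp Xquo_coef -mcoeff_msupp => /hg.
by rewrite mdegD mdegMn mdeg1; lia.
Qed.

Lemma homogzN (e : int) (g : S) : homogz e g -> homogz e (- g).
Proof. by move=> h; rewrite -sub0r; apply: homogzB => //; apply: homogz0. Qed.

Lemma homogz_sign (e : int) (g : S^o) a : homogz e g -> homogz e ((-1) ^+ a *: g : S^o).
Proof.
by move=> hu; rewrite -signr_odd scaler_sign; case: odd => //; apply: homogzN.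
Qed.

Definition Xpow N := fun l : 'I_n => 'X_l ^+ N : S.

Definition poly_cochain j N (c : {set 'I_n} -> S^o) :=
  forall A : {set 'I_n}, homogz (j + (N * #|A|)%N%:Z) (c A).

Lemma kosz_up_homogz j N c : poly_cochain j N c -> poly_cochain j N (kosz_up (Xpow N) c).
Proof.
move=> hc B; apply: homogz_sum => l lB; apply: homogz_sign.
have -> : j + (N * #|B|)%N = N%:Z + (j + (N * #|B :\ l|)%N).
  by rewrite (cardsD1 l B) lB; lia.
by apply: homogzM => //; apply: XE_homog.
Qed.

(** The variables are treated one at a time, each by subtracting the coboundary of the contraction
    built on [Xquo]. *)
Lemma poly_cech_reduce j N p (s : seq 'I_n) c : poly_cochain j N c ->
  (forall B : {set 'I_n}, #|B| = p.+1 -> kosz_up (Xpow N) c B = 0) ->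
  exists b, poly_cochain j N b /\
    forall A : {set 'I_n}, #|A| = p -> forall l, l \in s -> forall m,
      m \in msupp (c A - kosz_up (Xpow N) b A : S) -> (l \in A) && (m l < N)%N.
Proof.
move=> hc cyc; elim: s => [|l s [b [hb eb]]].
  by exists (fun=> 0); split=> // A; apply: homogz0.
pose c' A := c A - kosz_up (Xpow N) b A.
have hc' : poly_cochain j N c'.
  by move=> A; apply: homogzB; [apply: hc | apply: kosz_up_homogz].
have cyc' (B : {set 'I_n}) : #|B| = p.+1 -> kosz_up (Xpow N) c' B = 0.
  move=> hB; rewrite /c' /kosz_up.
  under eq_bigr => i _ do rewrite !scalerBr.
  by rewrite sumrB; apply/eqP; rewrite subr_eq0 [X in X == _]cyc // [X in _ == X]kosz_up_up.
pose h := kosz_contr l (Xquo l N) c'.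
have hh : poly_cochain j N h.
  move=> A; rewrite /h /kosz_contr; case: ifPn => lA; first exact: homogz0.
  apply: homogz_sign; have := @Xquo_homogz l N _ _ (hc' (l |: A)).
  by rewrite cardsU1 lA (_ : j + (N * (true + #|A|))%N%:Z - N%:Z = j + (N * #|A|)%N%:Z) //; lia.
exists (fun A => b A + h A); split.
  move=> A; rewrite -[h A]opprK; apply: homogzB => //; exact: homogzN.
move=> A hA i.
have -> : c A - kosz_up (Xpow N) (fun A => b A + h A) A = c' A - kosz_up (Xpow N) h A.
  rewrite /c' -addrA -opprD; congr (_ - _); rewrite /kosz_up -big_split.
  by apply: eq_bigr => i' _; rewrite !scalerDr.
have XM m' v : m' != l -> Xquo l N (Xpow N m' *: v) = Xpow N m' *: Xquo l N v.
  exact: XquoM.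
(* If l is in A, only monomials of c' with exponent of l below N are kept, so the bounds for the
   earlier variables persist; otherwise the cocycle condition makes the new cochain zero at A. *)
case: (boolP (l \in A)) => lA.
  rewrite (kosz_contr_in _ _ _ lA) // => his m.
  rewrite mcoeff_msupp mcoeffB mcoeffXnM Xquo_coef.
  case: ifPn => hm; first rewrite submK ?subrr ?eqxx //.
    apply/mnm_lepP => i'; rewrite mulmnE mnm1E.
    by case: eqVneq => [<-|]; rewrite ?mul1n ?mul0n.
  rewrite subr0 -mcoeff_msupp => hm'.
  move: his; rewrite inE => /predU1P[->|his]; first by rewrite lA ltnNge.
  exact: (eb _ hA _ his).
have /eqP := kosz_contr_notin XM c' lA.
rewrite [X in _ + X](_ : _ = 0); last first.
  by rewrite /kosz_contr (negbTE lA) cyc' ?raddf0 ?scaler0 // cardsU1 lA hA.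
rewrite addr0 => /eqP ->; rewrite [X in _ - X](XquoK l N (c' A)) subrr => _ m.
by rewrite msupp0.
Qed.

(** A monomial surviving the reduction forces A to be the full set and has all exponents at most N -
    1. Its degree j + N n is then at most n (N - 1), which means j <= -n. *)
Lemma poly_cech_exact j N p c : poly_cochain j N c ->
  ((p < n)%N \/ p = n /\ 0 < j + n%:Z) ->
  (forall B : {set 'I_n}, #|B| = p.+1 -> kosz_up (Xpow N) c B = 0) ->
  exists b, poly_cochain j N b /\
    forall A : {set 'I_n}, #|A| = p -> c A = kosz_up (Xpow N) b A.
Proof.
move=> hc hp cyc; have [b [hb eb]] := poly_cech_reduce (enum 'I_n) hc cyc.
exists b; split=> // A hA; apply/eqP; rewrite -subr_eq0 -msupp_eq0.
case e: msupp => [//|m s]; exfalso.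
have hm : m \in msupp (c A - kosz_up (Xpow N) b A : S) by rewrite e mem_head.
have hl l : (l \in A) && (m l < N)%N by apply: (eb _ hA l _ _ hm); rewrite mem_enum.
have AT : A = [set: 'I_n] by apply/setP => l; rewrite inE; case/andP: (hl l).
have pn : p = n by rewrite -hA AT cardsT card_ord.
have hj : 0 < j + n%:Z by case: hp => [|[]//]; rewrite pn ltnn.
have dm : (mdeg m)%:Z = j + (N * n)%N%:Z.
  have h : homogz (j + (N * #|A|)%N%:Z) (c A - kosz_up (Xpow N) b A : S).
    by apply: homogzB; [apply: hc | apply: kosz_up_homogz].
  by rewrite (h m hm) hA pn.
have : (\sum_(l < n) (m l).+1 <= \sum_(l < n) N)%N.
  by apply: leq_sum => l _; case/andP: (hl l).
rewrite sum_nat_const card_ord.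
under eq_bigr => l _ do rewrite -addn1.
by rewrite big_split /= sum_nat_const card_ord -mdegE muln1; lia.
Qed.

End FreeModule.

(** * Koszul modules *)

Lemma gm_components_eq (k : fieldType) n (M : gradedModule k n) (s s' : seq int)
    (c c' : int -> M) j : uniq s -> uniq s' ->
  (forall i, gm_piece M i (c i)) -> (forall i, gm_piece M i (c' i)) ->
  \sum_(i <- s) c i = \sum_(i <- s') c' i ->
  (if j \in s then c j else 0) = (if j \in s' then c' j else 0).
Proof.
move=> us us' hc hc' e; pose u := undup (j :: s ++ s').
have ju : j \in u by rewrite mem_undup mem_head.
have uu : uniq u by exact: undup_uniq.
pose a i := (if i \in s then c i else 0) - (if i \in s' then c' i else 0).
suff : a j = 0 by move/eqP; rewrite subr_eq0 => /eqP.
apply: (@gm_indep k n M u a uu _ _ j ju) => [i|].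
  by apply: gm_pieceB; case: ifP => _ //; apply: gm_piece0.
have su (q : seq int) (F : int -> M) : uniq q -> {subset q <= u} ->
    \sum_(i <- u) (if i \in q then F i else 0) = \sum_(i <- q) F i.
  move=> uq qu; rewrite -big_mkcond -big_filter; apply: perm_big.
  apply: uniq_perm => //; first by rewrite filter_uniq.
  by move=> i; rewrite mem_filter; case: (boolP (i \in q)) => // /qu ->.
have sub q : {subset q <= s ++ s'} -> {subset q <= u}.
  by move=> h i /h; rewrite mem_undup inE orbC => ->.
rewrite sumrB su ?su //; first by rewrite e subrr.
  by apply: sub => i hi; rewrite mem_cat hi orbT.
by apply: sub => i hi; rewrite mem_cat hi.
Qed.

Lemma gm_component (k : fieldType) n (M : gradedModule k n) (s : seq int)
    (c : int -> M) j v : uniq s -> (forall i, gm_piece M i (c i)) ->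
  gm_piece M j v -> v = \sum_(i <- s) c i -> v = if j \in s then c j else 0.
Proof.
move=> us hc hv e; pose c' i := if i == j then v else 0.
have hc' i : gm_piece M i (c' i).
  by rewrite /c'; case: eqP => [->|_] //; apply: gm_piece0.
rewrite (@gm_components_eq k n M s [:: j] c c' j us _ hc hc') //.
  by rewrite mem_head /c' eqxx.
by rewrite big_seq1 /c' eqxx e.
Qed.

Section Corestriction.
Variables (k : fieldType) (n : nat) (X M : gradedModule k n) (N : gradedSub M).
Variables (phi : {linear X -> M}) (hphi : forall x, gs_set N (phi x)).

Definition gm_corestr (x : X) : gm_sub N :=
  GmSub (introT (gs_predP N _) (hphi x)).

Lemma gm_corestr_is_linear : linear gm_corestr.
Proof. by move=> p u v; apply: val_inj; rewrite /= !linearP. Qed.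
HB.instance Definition _ :=
  GRing.isLinear.Build {mpoly k[n]} X (gm_sub N) _ gm_corestr gm_corestr_is_linear.

End Corestriction.

Section SubQuotientSes.
Variables (k : fieldType) (n : nat) (M : gradedModule k n) (N : gradedSub M).

Definition gm_incl : {linear gm_sub N -> M} := val.

Lemma gm_pi_is_scalable : scalable (gm_pi N).
Proof. by move=> p u; rewrite gm_piZ. Qed.
HB.instance Definition _ :=
  GRing.isScalable.Build {mpoly k[n]} M (gm_quot_type N) _ (gm_pi N) gm_pi_is_scalable.

Definition gm_proj : {linear M -> gm_quot N} := gm_pi N.

Lemma sub_quot_ses : graded_ses gm_incl gm_proj.
Proof.
split=> //.
- by move=> j u hu; exists u.
- by move=> u hu; apply: val_inj; rewrite raddf0.
- by move=> u; apply/gm_pi_eq0/gs_predP; apply: valP.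
- move=> j v hv /gm_pi_eq0/gs_predP hN; exists (GmSub hN); split=> //.
- by move=> j w [u hu ->]; exists u.
Qed.

End SubQuotientSes.

Section KoszulModules.
Variables (k : fieldType) (n r : nat) (d : 'I_r -> nat) (f : 'I_r -> {mpoly k[n]}).
Local Notation S := {mpoly k[n]}.
Local Notation ext := (ext k n r).
Implicit Types (t : int) (x : ext) (A B : {set 'I_r}).

Lemma koszul_dE x B : koszul_d f x B = kosz_down (V := S^o) f x B.
Proof.
rewrite ffunE; apply: eq_bigr => l _; rewrite /GRing.scale /= mulrA; congr (_ * _).
Qed.

Lemma koszul_dd x : koszul_d f (koszul_d f x) = 0.
Proof.
apply/ffunP => B; rewrite koszul_dE ffunE -[RHS](kosz_down_down (V := S^o) f x B).
by rewrite /kosz_down; apply: eq_bigr => l _; rewrite koszul_dE.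
Qed.

Lemma koszul_d_position t x :
  ext_in_position (t + 1) x -> ext_in_position t (koszul_d f x).
Proof.
move=> hx A hA; rewrite ffunE big1 // => l lA.
rewrite hx ?mulr0 // cardsU1 lA add1n => h; by apply: hA; lia.
Qed.

Definition ext_wedge (l : 'I_r) x : ext :=
  [ffun A => kosz_wedge (V := S^o) l x A].

Lemma ext_wedge_position t l x :
  ext_in_position t x -> ext_in_position (t + 1) (ext_wedge l x).
Proof.
move=> hx A hA; rewrite ffunE /kosz_wedge; case: ifPn => // lA.
by rewrite hx ?scaler0 // => h; apply: hA; rewrite (cardsD1 l A) lA PoszD addrC h.
Qed.

Lemma koszul_d_wedge l x :
  koszul_d f (ext_wedge l x) + ext_wedge l (koszul_d f x) = f l *: x.
Proof.
apply/ffunP => B; rewrite ffunE [X in X + _]koszul_dE [X in _ + X]ffunE.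
rewrite [RHS]ffunE -[RHS](kosz_wedgeP (V := S^o) f l x B).
congr (_ + _); first by apply: eq_bigr => m _; rewrite ffunE.
by rewrite /kosz_wedge; case: ifP => // lB; rewrite koszul_dE.
Qed.

Lemma term_set0 t : ext_in_position (k := k) (n := n) (r := r) t 0.
Proof. by move=> A _; rewrite ffunE. Qed.

Lemma term_set_lin t (p : S) (u v : ext_gm k n d) :
  ext_in_position t u -> ext_in_position t v -> ext_in_position t (p *: u + v).
Proof. by move=> hu hv A hA; rewrite !ffunE hu ?hv // scaler0 addr0. Qed.

Definition term_sub t : gradedSub (ext_gm k n d) :=
  @GradedSub k n (ext_gm k n d) (ext_in_position t) (@term_set0 t)
    (@term_set_lin t) (@ext_in_position_homog k n r d t).

Definition koszul_term t : gradedModule k n := gm_sub (term_sub t).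

Hypothesis f_homog : forall l, f l \is (d l).-homog.

Definition cycle_sub t : gradedSub (ext_gm k n d) :=
  GradedSub (cycle_set0 d f t) (@cycle_set_lin k n r d f t)
    (@cycle_set_homog k n r d f f_homog t).

Definition boundary_sub t : gradedSub (koszul_cycles f_homog t) :=
  GradedSub (boundary_set0 f_homog t) (@boundary_set_lin k n r d f f_homog t)
    (@boundary_set_homog k n r d f f_homog t).

(** Taken inside the cycles, so that the quotient is [koszul_homology] itself; elements are
    therefore compared through two applications of [val]. *)
Definition koszul_boundaries t : gradedModule k n := gm_sub (boundary_sub t).

Definition cycle_val t : {linear koszul_cycles f_homog t -> ext_gm k n d} := val.

Lemma cycle_val_position t (z : koszul_cycles f_homog t) :
  ext_in_position t (cycle_val t z).
Proof. by have /gs_predP[] := valP z. Qed.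

Lemma cycle_val_d t (z : koszul_cycles f_homog t) : koszul_d f (cycle_val t z) = 0.
Proof. by have /gs_predP[] := valP z. Qed.

Definition cycle_to_term t : {linear koszul_cycles f_homog t -> koszul_term t} :=
  @gm_corestr k n _ _ (term_sub t) (cycle_val t) (@cycle_val_position t).

Definition term_val t : {linear koszul_term t -> ext_gm k n d} := val.

Lemma term_val_position t (y : koszul_term t) : ext_in_position t (term_val t y).
Proof. by have /gs_predP := valP y. Qed.

Definition term_d t : {linear koszul_term t -> ext_gm k n d} :=
  (koszul_d f : {linear ext_gm k n d -> ext_gm k n d}) \o term_val t.

Lemma term_d_cycle t (y : koszul_term (t + 1)) : cycle_set (d := d) f t (term_d (t + 1) y).
Proof.
split; last exact: koszul_dd.
by apply: koszul_d_position; apply: term_val_position.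
Qed.

Definition term_to_cycle t : {linear koszul_term (t + 1) -> koszul_cycles f_homog t} :=
  gm_corestr (N := cycle_sub t) (@term_d_cycle t).

Lemma term_to_cycle_boundary t (y : koszul_term (t + 1)) :
  boundary_set (term_to_cycle t y).
Proof. by exists (term_val (t + 1) y); first exact: term_val_position. Qed.

Definition term_to_boundary t :
    {linear koszul_term (t + 1) -> koszul_boundaries t} :=
  gm_corestr (N := boundary_sub t) (@term_to_cycle_boundary t).

Lemma cycle_term_boundary_ses t :
  graded_ses (cycle_to_term (t + 1)) (term_to_boundary t).
Proof.
split=> //.
- by move=> j v hv; apply: koszul_d_piece.
- by move=> u /(congr1 val) hu; apply: val_inj.
- by move=> u; apply: val_inj; apply: val_inj; apply: cycle_val_d.
- move=> j v hv /(congr1 val)/(congr1 val) /= dv.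
  have cv : cycle_set (d := d) f (t + 1) (term_val (t + 1) v).
    by split; [apply: term_val_position | apply: dv].
  exists (GmSub (introT (gs_predP (cycle_sub (t + 1)) _) cv)); split=> //.
  exact: val_inj.
- move=> j w hw; have /gs_predP[y hy ey] := valP w.
  have [s [c [us hc ec]]] := ext_decomp d y.
  (* The given preimage y need not be homogeneous; its component of degree j already maps to w. *)
  pose b := if j \in s then c j else 0.
  have hb : ext_in_position (t + 1) b.
    rewrite /b; case: ifP => [js|_]; last by move=> A _; rewrite ffunE.
    by apply: (ext_in_position_homog us hc) js; rewrite -ec.
  have pb : ext_piece d j b by rewrite /b; case: ifP => _ //; apply: ext_piece0.
  exists (GmSub (introT (gs_predP (term_sub (t + 1)) _) hb)); split=> //.
  apply: val_inj; apply: val_inj; rewrite /= ey.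
  rewrite [RHS](@gm_component k n (ext_gm k n d) s (fun i => koszul_d f (c i)) j) //.
  - by rewrite /b; case: ifP => // _; rewrite raddf0.
  - by move=> i; apply: koszul_d_piece.
  - by rewrite -ey.
  - by rewrite ec raddf_sum.
Qed.
End KoszulModules.

Section KoszulTerms.
Variables (k : fieldType) (n r : nat) (d : 'I_r -> nat) (f : 'I_r -> {mpoly k[n]}).
Local Notation S := {mpoly k[n]}.

Lemma extZE (p : S) (x : ext_gm k n d) (Q : {set 'I_r}) :
  (p *: x : ext_gm k n d) Q = p *: (x Q : S^o) :> S^o.
Proof. by rewrite ffunE. Qed.

(** K_t is a direct sum of copies of S shifted by deg e_Q, so the coboundary equation is solved
    coordinate by coordinate in degree j - deg e_Q. *)
Lemma lc_vanish_term (t : int) p j :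
  ((p < n)%N \/
   p = n /\ forall Q : {set 'I_r}, #|Q|%:Z = t -> ext_deg d Q < j + n%:Z) ->
  lc_vanish (koszul_term k n d t) p j.
Proof.
move=> hp N c hc cyc.
pose cQ Q (A : {set 'I_n}) : S^o := term_val k n d t (c A) Q.
have hcQ Q : poly_cochain (j - ext_deg d Q) N (cQ Q).
  by move=> A; rewrite addrAC; apply: hc.
have dQ (b : {set 'I_n} -> koszul_term k n d t) Q B :
    term_val k n d t (cech_d N b B) Q = kosz_up (Xpow k N) (fun A => term_val k n d t (b A) Q : S^o) B.
  rewrite /cech_d linear_sum sum_ffunE; apply: eq_bigr => l _.
  by rewrite 2!(linearZ_LR (term_val k n d t)) 2!extZE.
have /choice[b hb] : forall Q : {set 'I_r}, exists b : {set 'I_n} -> S^o,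
    poly_cochain (j - ext_deg d Q) N b /\ (#|Q|%:Z = t -> 
    forall A : {set 'I_n}, #|A| = p -> cQ Q A = kosz_up (Xpow k N) b A).
  move=> Q; case: (eqVneq (#|Q|%:Z) t) => [e|/eqP ne]; last first.
    by exists (fun=> 0); split=> // A; apply: homogz0.
  have [||b [hb eb]] := @poly_cech_exact k n (j - ext_deg d Q) N p (cQ Q) (hcQ Q).
  - by case: hp => [|[-> /(_ Q e)]]; [left | right; split=> //; lia].
  - by move=> B hB; rewrite -dQ cyc // linear0 ffunE.
  by exists b.
pose bA (A : {set 'I_n}) : ext k n r := [ffun Q : {set 'I_r} => if #|Q|%:Z == t then b Q A else 0].
have bP A : ext_in_position t (bA A).
  by move=> Q /eqP/negbTE hQ; rewrite ffunE hQ.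
pose b' (A : {set 'I_n}) : koszul_term k n d t := GmSub (introT (gs_predP (term_sub k n d t) _) (bP A)).
exists 0%N, (cech_push 0 b'); split.
  apply: cech_push_homog => A Q; rewrite /= ffunE; case: ifP => _; last exact: homogz0.
  by have [+ _] := hb Q => /(_ A); rewrite addrAC.
move=> A hA; rewrite cech_d_push /cech_push expr0 !scale1r.
apply: val_inj; apply/ffunP => Q; rewrite [RHS]dQ.
case: (eqVneq (#|Q|%:Z) t) => [e|/eqP ne].
  rewrite [LHS](proj2 (hb Q) e A hA); apply: eq_bigr => l _.
  by rewrite ffunE e eqxx.
rewrite [LHS](term_val_position (c A) ne) /kosz_up big1 // => l _.
by rewrite ffunE; move/eqP/negbTE: ne => ->; rewrite !scaler0.
Qed.

Hypothesis f_homog : forall l, f l \is (d l).-homog.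

(** For a cycle u, [koszul_d_wedge] reads f_l u = d(e_l /\ u). *)
Lemma koszul_homology_annihilated t l (z : koszul_homology f_homog t) : f l *: z = 0.
Proof.
have [u ->] := gm_pi_surj z; rewrite -gm_piZ; apply/gm_pi_eq0.
exists (ext_wedge l (val u)).
  by apply: ext_wedge_position; apply: (cycle_val_position u).
apply: etrans (_ : _ = f l *: (val u : ext k n r)) _; first by [].
rewrite -koszul_d_wedge (_ : koszul_d f (val u) = 0); last exact: (cycle_val_d u).
rewrite [X in _ + X](_ : _ = 0) ?addr0 //; apply/ffunP => A.
by rewrite !ffunE /kosz_wedge; case: ifP => //; rewrite ffunE scaler0.
Qed.

End KoszulTerms.

(** * Mumford's lemma: generation in degree b from vanishing of H^p in degree b - p *)

Section MumfordLemma.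
Variables (k : fieldType) (n : nat) (M : gradedModule k n) (b : int).
Hypothesis van : forall p, (p <= n)%N -> lc_vanish M p (b - p%:Z).
Implicit Types (A B Q : {set 'I_n}).

Lemma card_le_n A : (#|A| <= n)%N.
Proof. by move: (max_card (mem A)); rewrite card_ord. Qed.

(** On the diagonal element, the sum over Q of (u / x_Q) e_Q, the Cech and Koszul differentials
    agree. *)
Lemma delta_cochain_d Q N (u : M) B :
  cech_d N.+1 (fun A => if A == Q then xset k A ^+ N *: u else 0) B =
  kosz_down (fun l => 'X_l) (fun Q' => if B == Q' then xset k B ^+ N *: u else 0) Q.
Proof.
rewrite /cech_d /kosz_down big_mkcond [RHS]big_mkcond; apply: eq_bigr => l _.
case: (boolP (l \in B)) => lB; case: (boolP (l \in Q)) => lQ //=.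
- case: eqP => e; first by move: lQ; rewrite -e setD11.
  by rewrite !scaler0.
- have -> : (B :\ l == Q) = (B == l |: Q).
    by apply/eqP/eqP => [<-|->]; rewrite ?setD1K ?setU1K.
  case: eqP => e; last by rewrite !scaler0.
  rewrite -/(sg B l) {1}e sg_setU1_id; congr (_ *: _).
  by rewrite !scalerA (xset_exp_setD1 k N lB) exprS mulrA.
- case: eqP => e; first by move: lB; rewrite e setU11.
  by rewrite !scaler0.
Qed.

Lemma cech_d_kosz_down N (w : {set 'I_n} -> {set 'I_n} -> M) Q B :
  cech_d N (fun A => kosz_down (fun l => 'X_l) (fun Q' => w Q' A) Q) B =
  kosz_down (fun l => 'X_l) (fun Q' => cech_d N (w Q') B) Q.
Proof.
rewrite /cech_d /kosz_down.
under eq_bigr => l _ do rewrite !scaler_sumr.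
under [RHS]eq_bigr => l _ do rewrite !scaler_sumr.
rewrite exchange_big; apply: eq_bigr => l _; apply: eq_bigr => m _.
rewrite !scalerA; congr (_ *: _).
by move: ((-1) ^+ _) ((-1) ^+ _) => a e; ring.
Qed.

(* [w Q] is the component at e_Q of the descent through the double complex of
   Cech cochains with values in the Koszul complex of x_1, ..., x_n, started
   from the element u / x_Q of M_{x_Q}, whose numerator is [xset Q ^+ N *: u]. *)
Lemma mumford_descent u : gm_piece M b u ->
  forall s, exists N (w : {set 'I_n} -> {set 'I_n} -> M),
  (forall Q, cech_homog (b - #|Q|%:Z) N.+1 (w Q)) /\
  forall Q, (n < s + #|Q|)%N -> forall A, #|A| = #|Q| ->
    cech_d N.+1 (w Q) A = (if A == Q then xset k A ^+ N *: u else 0)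
       - kosz_down (fun l => 'X_l) (fun Q' => w Q' A) Q.
Proof.
move=> hu; elim=> [|s [N [w [hw ew]]]].
  exists 0%N, (fun _ _ => 0); split=> [Q A|Q]; first exact: gm_piece0.
  by rewrite add0n ltnNge card_le_n.
pose c Q A := (if A == Q then xset k A ^+ N *: u else 0)
       - kosz_down (fun l => 'X_l) (fun Q' => w Q' A) Q.
have hc Q : cech_homog (b - #|Q|%:Z) N.+1 (c Q).
  move=> A; apply: gm_pieceB.
    case: eqP => [->|_]; last exact: gm_piece0.
    by apply: gm_pieceZ_eq (xset_homog _ _ _) hu _; lia.
  apply: gm_piece_sum => l lQ; apply: gm_piece_sign.
  apply: gm_pieceZ_eq (XE_homog k l 1) (hw _ _) _.
  by rewrite cardsU1 lQ; lia.
have [||q hq] := @exists_common_bound {set 'I_n} (fun Q q => n = (s + #|Q|)%N ->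
    exists b', cech_homog (b - #|Q|%:Z) (N.+1 + q) b' /\
      forall A, #|A| = #|Q| -> cech_push q (c Q) A = cech_d (N.+1 + q) b' A).
- move=> Q; case: (eqVneq n (s + #|Q|)%N) => [e|/eqP ne]; last by exists 0%N.
  have Qn := card_le_n Q.
  have [B hB|q [b' hb']] := van Qn (hc Q); last by exists q => _; exists b'.
  (* The right-hand side is a cocycle: by the equations already solved on the sets l |: Q, its
     coboundary is a double Koszul differential. *)
  rewrite cech_dB delta_cochain_d cech_d_kosz_down.
  rewrite -[RHS](kosz_down_down (fun l => 'X_l : {mpoly k[n]}) (fun Q' => w Q' B) Q).
  rewrite /kosz_down -sumrB; apply: eq_bigr => l lQ.
  rewrite -!scalerBr; congr (_ *: (_ *: _)).
  rewrite ew ?opprB 1?addrC ?subrK //; first by rewrite cardsU1 lQ; lia.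
  by rewrite hB cardsU1 lQ.
- move=> Q q q' h hQ; have [b' [hb' eb']] := h hQ.
  exists (cech_push q' b'); rewrite addnA; split.
    exact: cech_push_homog.
  by move=> A hA; rewrite cech_d_push -eb' // /cech_push scalerA -exprD addnC.
(* New primitives are taken exactly on the sets of size n - s; elsewhere the old ones are pushed to
   the new exponent. *)
have /choice[w' hw'] : forall Q, exists b', cech_homog (b - #|Q|%:Z) (N.+1 + q) b' /\
   if n == (s + #|Q|)%N then
   forall A, #|A| = #|Q| -> cech_push q (c Q) A = cech_d (N.+1 + q) b' A
   else b' = cech_push q (w Q).
  move=> Q; case: eqP => [e|_]; first exact: hq.
  by exists (cech_push q (w Q)); split=> //; apply: cech_push_homog.
exists (N + q)%N, w'; rewrite -addSn; split=> [Q|Q]; first by case: (hw' Q).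
rewrite addSn ltnS => hQ A hA.
have -> : (if A == Q then xset k A ^+ (N + q) *: u else 0)
       - kosz_down (fun l => 'X_l) (fun Q' => w' Q' A) Q = cech_push q (c Q) A.
  rewrite /cech_push /c scalerBr; congr (_ - _).
    by case: ifP; rewrite ?scaler0 // scalerA -exprD addnC.
  rewrite /kosz_down scaler_sumr; apply: eq_bigr => l lQ.
  have [_] := hw' (l |: Q); rewrite cardsU1 lQ; case: eqP => [|_ ->]; first by lia.
  rewrite /cech_push !scalerA; congr (_ *: _).
  by move: ((-1) ^+ _) (_ ^+ q) => a e; ring.
have [_] := hw' Q; case: eqP => [_ ->|/eqP ne ->] //.
rewrite cech_d_push ew //; by lia.
Qed.

(** At Q = A = empty set the Cech differential is an empty sum, and the last equation of the descent
    reads 0 = u - sum_l x_l w_l. *)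
Lemma piece_generated_of_lc_vanish u : gm_piece M b u ->
  exists w : 'I_n -> M, (forall l, gm_piece M (b - 1) (w l)) /\ u = \sum_l 'X_l *: w l.
Proof.
move=> hu; have [N [w [hw ew]]] := mumford_descent hu n.+1.
exists (fun l => w [set l] set0); split=> [l|].
  by have := hw [set l] set0; rewrite cards0 cards1 muln0 addr0.
have n0 : (n < n.+1 + #|set0 : {set 'I_n}|)%N by rewrite cards0 addn0.
have /esym/eqP := ew set0 n0 set0 erefl; rewrite /cech_d big_set0 eqxx.
rewrite /xset big_set0 expr1n scale1r subr_eq0 => /eqP ->.
rewrite /kosz_down; apply: eq_big => [l|l _]; first by rewrite inE.
rewrite setU0 /sg (_ : [set _ in _ | _] = set0) ?cards0 ?expr0 ?scale1r //.
by apply/setP => x; rewrite !inE.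
Qed.

End MumfordLemma.

(** * Suprema and homogeneous ideals *)

(** [supremum] selects a value by choice, so the content is that a least upper bound exists in Z
    with both infinities. *)
Lemma extsup_supremums (A : set extint) : (A !=set0)%classic -> supremums A (extsup A).
Proof.
move=> A0; rewrite /extsup /supremum; case: ifPn => [/eqP e|_].
  by move: A0; rewrite e => -[].
case: xgetP => [x -> //|none]; exfalso.
suff [s /none//] : exists s, supremums A s.
pose U c := forall x, A x -> (x <= EFin (c : int))%O.
have [[c hc]|nU] := pselect (exists c, U c); last first.
  exists (EPInf int); split=> [x _|y hy]; first exact: leey.
  case: y hy => [c||] hy //; first by case: nU; exists c.
  by case: nU; exists 0 => x /hy; rewrite leeNy_eq => /eqP ->; exact: leNye.
have [hN|hN] := pselect (ubound A (ENInf int)).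
  by exists (ENInf int); split=> // y _; exact: leNye.
have [x Ax nx] : exists2 x, A x & ~~ (x <= ENInf int)%O.
  apply: contrapT => h; apply: hN => x Ax; apply: contrapT => nx.
  by apply: h; exists x => //; apply/negP.
case: x Ax nx => [a||] Ax nx; last by rewrite lexx in nx.
  (* With an integer a in the set, integer upper bounds have the form a + m with m natural; the
     least m gives the supremum. *)
  have exm : exists m : nat, `[< U (a + m%:Z) >].
    have ac : a <= c by have := hc _ Ax; rewrite lee_fin.
    exists `|c - a|%N; apply/asboolP; rewrite gez0_abs ?subr_ge0 //.
    by rewrite addrCA subrr addr0.
  case: (ex_minnP exm) => m /asboolP hm minm.
  exists (EFin (a + m%:Z)); split=> // y hy; case: y hy => [b||] hy; last 2 first.
  - exact: leey.
  - by move: nx; rewrite hy.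
  have ab : a <= b by have := hy _ Ax; rewrite lee_fin.
  have /minm : `[< U (a + `|b - a|%N%:Z) >].
    by apply/asboolP; rewrite gez0_abs ?subr_ge0 // addrCA subrr addr0.
  by rewrite lee_fin; lia.
by have := hc _ Ax.
Qed.

Lemma extsup_le (A : set extint) y :
  ((extsup A <= y)%O <-> forall x, A x -> (x <= y)%O).
Proof.
have [A0|h] := pselect (A !=set0)%classic; last first.
  have -> : A = classical_sets.set0.
    by apply/seteqP; split=> // x Ax; case: h; exists x.
  by rewrite /extsup supremum0; split=> // _; exact: leNye.
have [ub lb] := extsup_supremums A0.
split=> [h x /ub hx|h]; first exact: le_trans hx h.
exact: lb.
Qed.

(** * Homogeneous ideals and the construction of homogeneous primes *)

Section HomogeneousIdeals.
Variables (k : fieldType) (n : nat).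
Local Notation S := {mpoly k[n]}.
Local Notation pi e := (pihomog mdeg e).

Lemma pihomog_ge e (h : S) : (mmeasure mdeg h <= e)%N -> pi e h = 0.
Proof.
move=> le; rewrite pihomogE big_seq_cond big1 // => m /andP[/mmeasure_mnm_lt hm /eqP e'].
by move: (hm mdeg); rewrite e' ltnNge le.
Qed.

Lemma pihomogM_homog e d (h u : S) : u \is d.-homog ->
  pi e (h * u) = if (d <= e)%N then pi (e - d) h * u else 0.
Proof.
move=> hu; rewrite {1}(pihomog_partitionE (leqnn (mmeasure mdeg h))) mulr_suml raddf_sum /=.
have hi i : pi i h * u \is (i + d).-homog by apply: dhomogM => //; apply: pihomogP.
case: ifPn => de.
  case: (ltnP (e - d) (mmeasure mdeg h)) => lt.
    rewrite (bigD1 (Ordinal lt)) //= big1 ?addr0.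
      by rewrite pihomog_dE //; have := hi (Ordinal lt); rewrite /= subnK.
    move=> i /eqP ne; apply: pihomog_ne0 (hi i); apply/eqP => e'; apply: ne.
    by apply: val_inj => /=; lia.
  rewrite big1 => [|i _]; last first.
    by apply: pihomog_ne0 (hi i); have := ltn_ord i; lia.
  by rewrite (pihomog_ge lt) mul0r.
by rewrite big1 // => i _; apply: pihomog_ne0 (hi i); lia.
Qed.

Record homog_ideal (J : set S) : Prop := HomogIdeal {
  hi_0 : J 0;
  hi_lin : forall a u v, J u -> J v -> J (a * u + v);
  hi_homog : forall e u, J u -> J (pi e u)
}.

Lemma hi_mul J a u : homog_ideal J -> J u -> J (a * u).
Proof. by move=> hJ hu; rewrite -[_ * _]addr0; apply: hi_lin => //; apply: hi_0. Qed.

Lemma hi_add J u v : homog_ideal J -> J u -> J v -> J (u + v).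
Proof. by move=> hJ hu hv; rewrite -[u]mul1r; apply: hi_lin. Qed.

Lemma hi_sub J u v : homog_ideal J -> J u -> J v -> J (u - v).
Proof. by move=> hJ hu hv; rewrite addrC -mulN1r; apply: hi_lin. Qed.

Lemma hi_sum J (T : Type) (s : seq T) (P : pred T) (F : T -> S) : homog_ideal J ->
  (forall i, P i -> J (F i)) -> J (\sum_(i <- s | P i) F i).
Proof.
move=> hJ hF; elim/big_rec: _ => [|i u Pi hu]; first exact: hi_0.
by apply: hi_add => //; apply: hF.
Qed.

Definition ideal_adjoin (J : set S) (u : S) : set S :=
  fun p => exists a h, J a /\ p = a + h * u.

Lemma ideal_adjoin_homog J d u : homog_ideal J -> u \is d.-homog ->
  homog_ideal (ideal_adjoin J u).
Proof.
move=> hJ hu; split.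
- by exists 0, 0; rewrite mul0r addr0; split=> //; apply: hi_0.
- move=> a _ _ [b [h [hb ->]]] [b' [h' [hb' ->]]].
  exists (a * b + b'), (a * h + h'); split; first exact: hi_lin.
  by ring.
- move=> e _ [a [h [ha ->]]]; rewrite raddfD /= (pihomogM_homog _ _ hu).
  exists (pi e a), (if (d <= e)%N then pi (e - d) h else 0).
  by split; [apply: hi_homog | case: ifP; rewrite ?mul0r].
Qed.

Lemma ideal_adjoin_sub J u : (J `<=` ideal_adjoin J u)%classic.
Proof. by move=> a ha; exists a, 0; rewrite mul0r addr0. Qed.

Lemma ideal_adjoin_self J u : homog_ideal J -> ideal_adjoin J u u.
Proof. by move=> hJ; exists 0, 1; rewrite mul1r add0r; split=> //; apply: hi_0. Qed.

(** Let a and b be the highest degrees in which u and v have components outside J. Modulo J, the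
    component of degree a + b of u v is the product of these two. *)
Lemma homog_prime J : homog_ideal J -> ~ J 1 ->
  (forall d e u v, u \is d.-homog -> v \is e.-homog -> J (u * v) -> J u \/ J v) ->
  prime_ideal J.
Proof.
move=> hJ J1 hp; split=> //; [exact: hi_0 | by move=> *; apply: hi_lin |].
have top w : ~ J w -> exists a, ~ J (pi a w) /\ forall i, (a < i)%N -> J (pi i w).
  move=> nw; have exP : exists a, `[< ~ J (pi a w) >].
    apply: contrapT => h; apply: nw.
    rewrite (pihomog_partitionE (leqnn (mmeasure mdeg w))).
    apply: hi_sum => // i _; apply: contrapT => ni; apply: h.
    by exists (i : nat); apply/asboolP.
  have bd a : `[< ~ J (pi a w) >] -> (a <= mmeasure mdeg w)%N.
    move=> /asboolP; apply: contra_notT; rewrite -ltnNge => lt.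
    by rewrite pihomog_ge 1?ltnW //; exact: hi_0.
  case: (ex_maxnP exP bd) => a /asboolP ha maxa; exists a; split=> // i lt.
  apply: contrapT => /asboolP/maxa; lia.
move=> u v huv; apply: contrapT => /not_orP[/top[a [na ha]] /top[b [nb hb]]].
suff : J (pi a u * pi b v).
  by case/(hp a b _ _ (pihomogP _ _ _) (pihomogP _ _ _)).
have := hi_homog hJ (a + b) huv.
rewrite {1}(pihomog_partitionE (leqnn (mmeasure mdeg v))) mulr_sumr raddf_sum /=.
have [lt|ge] := ltnP b (mmeasure mdeg v); last first.
  by case: nb; rewrite pihomog_ge //; exact: hi_0.
rewrite (bigD1 (Ordinal lt)) //= (pihomogM_homog _ _ (pihomogP _ _ _)) leq_addl addnK.
set R := \sum_(i | _) _; move=> h.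
suff hR : J R by have := hi_sub hJ h hR; rewrite addrK.
apply: hi_sum => // i /eqP ne.
rewrite (pihomogM_homog _ _ (pihomogP _ _ _)); case: ifPn => _; last exact: hi_0.
case: (ltngtP i b) => [lt'|lt'|e].
- by rewrite mulrC; apply: hi_mul => //; apply: ha; lia.
- by apply: hi_mul => //; apply: hb.
- by case: ne; apply: val_inj.
Qed.

(** An ideal maximal among the homogeneous ideals over J0 outside [G] is prime. Since [G] is
    witnessed by finitely many elements, its failure passes to unions of nonempty chains. *)
Lemma exists_homog_prime (G : set S -> Prop) (J0 : set S) :
  (forall J, homog_ideal J -> J 1 -> G J) ->
  (forall J, G J -> exists s : seq S, (forall a, a \in s -> J a) /\
     forall J', (forall a, a \in s -> J' a) -> G J') ->
  (forall J d e u v, homog_ideal J -> u \is d.-homog -> v \is e.-homog ->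
     J (u * v) -> G (ideal_adjoin J u) -> G (ideal_adjoin J v) -> G J) ->
  homog_ideal J0 -> ~ G J0 ->
  exists P, [/\ homog_ideal P, prime_ideal P, (J0 `<=` P)%classic & ~ G P].
Proof.
move=> G1 Gfin Gstep hJ0 nJ0.
pose good J := [/\ homog_ideal J, (J0 `<=` J)%classic & ~ G J].
pose cand J := J = classical_sets.set0 \/ good J.
have [F Fc Ftot|P [candP maxP]] := @Zorn_bigcup S cand.
  have [[X0 [FX0 gX0]]|none] := pselect (exists X, F X /\ good X); last first.
    left; apply/seteqP; split=> // x [X FX Xx]; case: (Fc X FX) => [e|g].
      by move: Xx; rewrite e.
    by case: none; exists X.
  right; have FN X x : F X -> X x -> good X.
    by move=> FX Xx; case: (Fc X FX) => // e; move: Xx; rewrite e.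
  split.
  - split.
    + by exists X0 => //; case: gX0 => h _ _; apply: hi_0.
    + move=> a u v [X FX Xu] [Y FY Yv].
      have [XY|YX] := Ftot X Y FX FY.
        by exists Y => //; case: (FN _ _ FY Yv) => h _ _; apply: hi_lin => //; apply: XY.
      by exists X => //; case: (FN _ _ FX Xu) => h _ _; apply: hi_lin => //; apply: YX.
    + move=> e u [X FX Xu]; exists X => //.
      by case: (FN _ _ FX Xu) => h _ _; apply: hi_homog.
  - by move=> a ha; exists X0 => //; case: gX0 => _ h _; apply: h.
  - move=> /Gfin[s [hs mono]].
    have [X [FX gX hX]] : exists X, [/\ F X, good X & forall a, a \in s -> X a].
      elim: s hs {mono} => [|a s IH] hs; first by exists X0; split.
      have [b hb|X [FX gX hX]] := IH; first by apply: hs; rewrite inE hb orbT.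
      have [Y FY Ya] := hs a (mem_head _ _).
      have [XY|YX] := Ftot X Y FX FY.
        exists Y; split=> //; first exact: FN Ya.
        by move=> b; rewrite inE => /predU1P[->//|/hX/XY].
      by exists X; split=> // b; rewrite inE => /predU1P[->|/hX//]; apply: YX.
    by case: gX => _ _; apply; apply: mono.
have gJ0 : good J0 by split.
have gP : good P.
  case: candP => // e; exfalso; apply: (maxP J0); last by right.
  by rewrite e; split=> // /(_ 0 (hi_0 hJ0)).
case: gP => hP JP nP; exists P; split=> //.
apply: homog_prime => //; first by move=> h1; apply: nP; apply: G1.
move=> d e u v hu hv huv; apply: contrapT => /not_orP[nu nv]; apply: nP.
have Gadj d' w : w \is d'.-homog -> ~ P w -> G (ideal_adjoin P w).
  move=> hw nw; apply: contrapT => nG; apply: (maxP (ideal_adjoin P w)).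
    split; first exact: ideal_adjoin_sub.
    by move=> /(_ w (ideal_adjoin_self w hP)).
  right; split=> //; first exact: ideal_adjoin_homog hw.
  by move=> a /JP; apply: ideal_adjoin_sub.
by apply: (Gstep P d e u v) => //; [apply: Gadj hu nu | apply: Gadj hv nv].
Qed.

End HomogeneousIdeals.

(** * Vanishing in dimension at most one *)

Section MultiplicationSub.
Variables (k : fieldType) (n : nat) (M : gradedModule k n) (d : nat) (u : {mpoly k[n]}).
Hypothesis hu : u \is d.-homog.

Definition mul_set : set M := fun v => exists w, v = u *: w.

Lemma mul_set0 : mul_set 0.
Proof. by exists 0; rewrite scaler0. Qed.

Lemma mul_set_lin (p : {mpoly k[n]}) v v' :
  mul_set v -> mul_set v' -> mul_set (p *: v + v').
Proof.
move=> [w ->] [w' ->]; exists (p *: w + w').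
by rewrite scalerDr !scalerA mulrC.
Qed.

Lemma mul_set_homog (s : seq int) (c : int -> M) : uniq s ->
  (forall j, gm_piece M j (c j)) -> mul_set (\sum_(j <- s) c j) ->
  forall j, j \in s -> mul_set (c j).
Proof.
move=> us hc [w ew] j js; have [s' [w_ [us' hw_ eqw]]] := gm_decomp w.
pose s'' := [seq d%:Z + i | i <- s'].
have us'' : uniq s'' by rewrite map_inj_uniq // => a b /addrI.
pose c' i := u *: w_ (i - d%:Z).
have hc' i : gm_piece M i (c' i).
  by apply: gm_pieceZ_eq hu (hw_ _) _; rewrite addrCA subrr addr0.
have := @gm_components_eq k n M s s'' c c' j us us'' hc hc'; rewrite js => ->.
  by case: ifP => _; [exists (w_ (j - d%:Z)) | exists 0; rewrite scaler0].
rewrite ew eqw scaler_sumr big_map; apply: eq_bigr => i _.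
by rewrite /c' addrAC subrr add0r.
Qed.

Definition mul_sub : gradedSub M := GradedSub mul_set0 mul_set_lin mul_set_homog.

End MultiplicationSub.

Section HighCohomology.
Variables (k : fieldType) (n : nat).
Local Notation S := {mpoly k[n]}.
Implicit Types A B : {set 'I_n}.

(* [x_l0 ^ N] kills every class of level N; as x_l0 acts invertibly on M_{x_A}
   for A nonempty, it can be divided out of the primitive. *)
Lemma lc_vanish_invertible (M : gradedModule k n) (l0 : 'I_n) (N1 : nat)
    (h : 'I_n -> S) p j :
  (forall l, h l \is N1.-homog) ->
  (forall l (m : M), 'X_l ^+ N1.+1 *: m = (h l * 'X_l0) *: m) ->
  (2 <= p)%N -> lc_vanish M p j.
Proof.
move=> hh hX p2 N c hc cyc; pose q := (N1.+1 * N)%N.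
(* The exponent q = (N1 + 1) N is chosen so that x_l^q acts as h_l^N x_l0^N: inverting any x_l
   inverts x_l0. *)
have hXq l (m : M) : 'X_l ^+ q *: m = (h l ^+ N * 'X_l0 ^+ N) *: m.
  rewrite /q; elim: (N) m => [|i IH] m; first by rewrite muln0 !expr0 mul1r.
  rewrite mulnS exprD -scalerA IH hX scalerA.
  by rewrite !exprS; congr (_ *: _); ring.
pose idM : {additive M -> M} := idfun.
pose b := kosz_contr l0 idM c.
have hb A : gm_piece M (j + (N * #|A|.+1)%N%:Z) (b A).
  rewrite /b /kosz_contr; case: ifPn => lA; first exact: gm_piece0.
  by apply: gm_piece_sign; have := hc (l0 |: A); rewrite cardsU1 lA.
have db A : #|A| = p -> cech_d N b A = 'X_l0 ^+ N *: c A.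
  move=> hA; have idl m v : m != l0 -> idM ('X_m ^+ N *: v : M) = 'X_m ^+ N *: idM v by [].
  case: (boolP (l0 \in A)) => lA; first exact: (@kosz_contr_in _ _ _ (fun l => 'X_l ^+ N) l0 idM c A lA).
  rewrite -[RHS](@kosz_contr_notin _ _ _ (fun l => 'X_l ^+ N) l0 idM idl c A lA).
  rewrite [X in _ = _ + X](_ : _ = 0) ?addr0 //.
  by rewrite /kosz_contr (negbTE lA) -cech_d_up cyc ?scaler0 // cardsU1 lA hA.
(* Numerator over x_A^(N+q) of the fraction b A / x_A^N divided by x_l0^N: for l in A, 1 / x_l0^N is
   h_l^N / x_l^q. *)
pose b' A : M := if [pick l in A] is Some l then (h l ^+ N * xset k (A :\ l) ^+ q) *: b A else 0.
have hb' : cech_homog j (N + q) b'.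
  move=> A; rewrite /b'; case: pickP => [l lA|_]; last exact: gm_piece0.
  have hp : h l ^+ N * xset k (A :\ l) ^+ q \is (N1 * N + q * #|A :\ l|).-homog.
    by apply: dhomogM; [apply: dhomogMn | apply: xset_homog].
  apply: gm_pieceZ_eq hp (hb A) _; rewrite [in #|A|](cardsD1 l A) lA /q; lia.
have Xb' A : A != set0 -> 'X_l0 ^+ N *: b' A = xset k A ^+ q *: b A.
  move=> A0; rewrite /b'; case: pickP => [l lA|A0']; last first.
    by case/set0Pn: A0 => l; rewrite A0'.
  rewrite (xset_exp_setD1 k q lA) mulrC -scalerA hXq !scalerA.
  by congr (_ *: _); ring.
(* An equation on nonempty sets may thus be checked after multiplication by x_l0^N, at the price of
   a second push by q. *)
have X0 A (m : M) : A != set0 -> 'X_l0 ^+ N *: m = 0 -> xset k A ^+ q *: m = 0.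
  move=> /set0Pn[l lA] m0; rewrite (xset_exp_setD1 k q lA) mulrC -scalerA hXq.
  by rewrite -(scalerA (h l ^+ N)) m0 !scaler0.
exists (q + q)%N, (cech_push q b'); rewrite addnA; split; first exact: cech_push_homog.
move=> A hA; rewrite cech_d_push; apply/eqP; rewrite -subr_eq0.
rewrite /cech_push exprD -scalerA -scalerBr; apply/eqP/X0.
  by rewrite -card_gt0 hA; lia.
rewrite scalerBr scalerA mulrC -scalerA -db // -cech_d_push; apply/eqP.
rewrite subr_eq0; apply/eqP.
have -> : 'X_l0 ^+ N *: cech_d (N + q) b' A = cech_d (N + q) (fun A => 'X_l0 ^+ N *: b' A) A.
  rewrite /cech_d scaler_sumr; apply: eq_bigr => l _; rewrite !scalerA.
  by congr (_ *: _); move: ((-1) ^+ _) => a; ring.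
(* Here p >= 2 is used: a set of size p - 1 must be nonempty for x_l0 to be divided out on it. *)
apply: (@eq_cech_d _ _ _ _ p.-1) => [|B hB]; first by rewrite hA; lia.
by rewrite Xb' // -card_gt0 hB; lia.
Qed.

(** The finite list, instead of all of J, provides the finite witness that [exists_homog_prime] asks
    for. *)
Definition kills_high (J : set S) := exists s : seq S, (forall a, a \in s -> J a) /\
  forall M : gradedModule k n, (forall a, a \in s -> forall u : M, a *: u = 0) ->
  forall p j, (2 <= p)%N -> lc_vanish M p j.

(** If u v kills M, then v kills uM and u kills M/uM; the exact sequence of uM in M carries the
    vanishing over. The listed elements of J + (u) and J + (v) are replaced by their parts in J. *)
Lemma kills_high_adjoin (J : set S) d u v : u \is d.-homog -> J (u * v) ->
  kills_high (ideal_adjoin J u) -> kills_high (ideal_adjoin J v) -> kills_high J.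
Proof.
move=> hu huv [s [hs vs]] [s' [hs' vs']].
have split_seq w (t : seq S) : (forall a, a \in t -> ideal_adjoin J w a) ->
    exists t' : seq S, (forall a, a \in t' -> J a) /\
      forall M : gradedModule k n, (forall a, a \in t' -> forall m : M, a *: m = 0) ->
      (forall m : M, w *: m = 0) -> forall a, a \in t -> forall m : M, a *: m = 0.
  elim: t => [|a t IH] ht; first by exists [::].
  have [b hb|t' [ht' kt']] := IH; first by apply: ht; rewrite inE hb orbT.
  have [a0 [h [Ja0 ea]]] := ht a (mem_head _ _).
  exists (a0 :: t'); split=> [b|M kM wM b].
    by rewrite inE => /predU1P[->|/ht'].
  rewrite inE => /predU1P[->|hb] m.
    by rewrite ea scalerDl kM ?mem_head // -scalerA wM scaler0 addr0.
  by apply: kt' => // b' hb'; apply: kM; rewrite inE hb' orbT.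
have [t [ht kt]] := split_seq _ _ hs; have [t' [ht' kt']] := split_seq _ _ hs'.
exists (u * v :: t ++ t'); split=> [a|M kM p j p2].
  by rewrite inE mem_cat => /predU1P[->//|/orP[/ht|/ht']].
apply: (lc_vanish_mid (sub_quot_ses (mul_sub M hu))).
- apply: vs' => //; apply: kt' => [a ha m|m]; apply: val_inj; rewrite /=.
    by rewrite kM // inE mem_cat ha !orbT.
  have /gs_predP[w ->] := valP m.
  by rewrite scalerA mulrC kM ?mem_head.
- apply: vs => //; apply: kt => [a ha m|m]; have [w ->] := gm_pi_surj m.
    by rewrite -gm_piZ kM ?raddf0 // inE mem_cat ha orbT.
  by rewrite -gm_piZ; apply/gm_pi_eq0; exists w.
Qed.

(** Components of degree N + 1 give x_l^(N+1) = a_l + h_l x_l0 with a_l in J and h_l of degree N. On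
    a module killed by the a_l this is the hypothesis of [lc_vanish_invertible]. *)
Lemma kills_high_base (J : set S) (l0 : 'I_n) : homog_ideal J ->
  (forall l : 'I_n, exists N, ideal_adjoin J 'X_l0 ('X_l ^+ N)) -> kills_high J.
Proof.
move=> hJ hX; have X1 : ('X_l0 : S) \is 1.-homog by rewrite dhomogX /= mdeg1.
have hJ' := ideal_adjoin_homog hJ X1.
have [|l N q hN|N hN] := @exists_common_bound 'I_n (fun l N => ideal_adjoin J 'X_l0 ('X_l ^+ N)).
- exact: hX.
- by rewrite exprD mulrC; apply: hi_mul.
have /choice[a ha] : forall l : 'I_n, exists ah : S * S,
    [/\ J ah.1, ah.2 \is N.-homog & 'X_l ^+ N.+1 = ah.1 + ah.2 * 'X_l0].
  move=> l; have [a [h [Ja e]]] : ideal_adjoin J 'X_l0 ('X_l ^+ N.+1).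
    by rewrite exprS; apply: hi_mul.
  exists (pihomog mdeg N.+1 a, pihomog mdeg N h); split.
  - exact: hi_homog.
  - exact: pihomogP.
  - have /pihomog_dE <- := XE_homog k l N.+1.
    by rewrite e raddfD /= (pihomogM_homog _ _ X1) ltnS leq0n subSS subn0.
exists [seq (a l).1 | l : 'I_n]; split=> [_ /mapP[l _ ->]|M kM p j].
  by case: (ha l).
apply: (@lc_vanish_invertible M l0 N (fun l => (a l).2)) => [l|l m].
  by case: (ha l).
have [_ _ ->] := ha l; rewrite scalerDl kM ?add0r //.
by apply/mapP; exists l; rewrite ?mem_enum.
Qed.

Lemma irrelevant_prime : prime_ideal (fun p : S => p@_0 = 0).
Proof.
split=> [|a u v hu hv||u v].
- by rewrite mcoeff0.
- have h0 (p p' : S) : (p * p')@_0 = p@_0 * p'@_0 by exact: rmorphM.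
  by rewrite mcoeffD h0 hu hv mulr0 addr0.
- by rewrite mcoeff1 eqxx; apply/eqP/oner_neq0.
- have -> : (u * v)@_0 = u@_0 * v@_0 by exact: rmorphM.
  by move/eqP; rewrite mulf_eq0 => /orP[]/eqP; [left | right].
Qed.

Lemma mcoeff_pihomog e (p : S) m :
  (pihomog mdeg e p)@_m = if mdeg m == e then p@_m else 0.
Proof.
rewrite pihomogE raddf_sum /=; under eq_bigr => i _ do rewrite mcoeffZ mcoeffX.
case: (boolP (m \in msupp p)) => h.
  rewrite big_mkcond (big_rem _ h) /= eqxx mulr1 big_seq big1 ?addr0 // => i.
  rewrite mem_rem_uniq ?msupp_uniq // inE => /andP[/negbTE -> _].
  by rewrite mulr0 if_same.
rewrite (memN_msupp_eq0 h) if_same big_seq_cond big1 // => i /andP[hi _].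
by case: eqVneq => [e'|]; rewrite ?mulr0 //; move: h; rewrite -e' hi.
Qed.

Lemma homog_proper_irrelevant (J : set S) u : homog_ideal J -> ~ J 1 -> J u -> u@_0 = 0.
Proof.
move=> hJ J1 Ju; apply: contrapT => /eqP u0; apply: J1.
have e : pihomog mdeg 0 u = (u@_0)%:MP.
  apply/mpolyP => m; rewrite mcoeffC mcoeff_pihomog mdeg_eq0.
  by case: eqVneq => [->|]; rewrite ?mulr1 ?mulr0.
have := hi_mul (u@_0)^-1%:MP hJ (hi_homog hJ 0 Ju).
by rewrite e -mpolyCM mulVf.
Qed.

(** A homogeneous prime P over J outside [kills_high] misses some x_l0, and by [kills_high_base]
    some x_l1 has no power in P + (x_l0). This leads to a chain of primes of length 2. *)
Lemma krull_dim_kills_high (J : set S) : homog_ideal J ->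
  (krull_dim_quot J <= EFin (1 : int))%O -> kills_high J.
Proof.
move=> hJ dim; have [n0|n0] := posnP n.
  exists [::]; split=> // M _ p j p2; apply: lc_vanish_gt; lia.
apply: contrapT => nJ.
have one (I : set S) : homog_ideal I -> I 1 -> kills_high I.
  move=> hI I1; apply: (@kills_high_base _ (Ordinal n0)) => // l.
  exists 0%N; rewrite expr0; exact: ideal_adjoin_sub.
have [|||P [hP primeP JP nP]] := @exists_homog_prime k n kills_high J _ _ _ hJ nJ.
- exact: one.
- move=> I [s [hs ks]]; exists s; split=> // I' hI'; by exists s.
- by move=> I d e u v _ hu _ huv; apply: (kills_high_adjoin hu huv).
have [l0 nl0] : exists l0 : 'I_n, ~ P 'X_l0.
  apply: contrapT => h; apply: nP; apply: (@kills_high_base _ (Ordinal n0)) => // l.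
  exists 1%N; rewrite expr1; apply: ideal_adjoin_sub.
  by apply: contrapT => nl; apply: h; exists l.
have [l1 nl1] : exists l1 : 'I_n, ~ exists N, ideal_adjoin P 'X_l0 ('X_l1 ^+ N).
  apply: contrapT => h; apply: nP; apply: (@kills_high_base _ l0) => // l.
  by apply: contrapT => nl; apply: h; exists l.
have X1 l : ('X_l : S) \is 1.-homog by rewrite dhomogX /= mdeg1.
(* The same maximality argument, now for the property of containing a power of x_l1, gives the
   middle prime of the chain. *)
have [|||Q [hQ primeQ PQ nQ]] := @exists_homog_prime k n
   (fun I => exists N, I ('X_l1 ^+ N)) (ideal_adjoin P 'X_l0) _ _ _
   (ideal_adjoin_homog hP (X1 l0)) nl1.
- by move=> I _ I1; exists 0%N.
- move=> I [N hN]; exists [:: 'X_l1 ^+ N]; split=> [a|I' hI'].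
    by rewrite inE => /eqP ->.
  by exists N; apply: hI'; rewrite mem_head.
- move=> I d e u v hI _ _ huv [N [a [h [Ia ea]]]] [N' [a' [h' [Ia' ea']]]].
  exists (N + N')%N; rewrite exprD ea ea'.
  have -> : (a + h * u) * (a' + h' * v) =
      (a' + h' * v) * a + (h * u) * a' + (h * h') * (u * v) by ring.
  by apply: hi_add => //; [apply: hi_add => //|]; apply: hi_mul.
have Q1 : ~ Q 1 by case: primeQ.
suff : ((2 : int) <= 1)%O by [].
rewrite -(lee_fin (R := int)).
apply: (proj1 (extsup_le _ _) dim); exists 2%N.
exists (fun i => if i is 0 then P else if i is 1 then Q else fun p : S => p@_0 = 0).
have PX : (P `<=` ideal_adjoin P 'X_l0)%classic by exact: ideal_adjoin_sub.
split=> //; split=> [[|[|i]] _|[|[|i]] _|[|[|i]] lt] //.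
- exact: irrelevant_prime.
- by move=> a /JP/PX/PQ.
- by move=> a /JP/PX/PQ; apply: homog_proper_irrelevant.
- split; first by move=> a /PX/PQ.
  by move=> /(_ 'X_l0 (PQ _ (ideal_adjoin_self _ hP))).
- split; first by move=> a; apply: homog_proper_irrelevant.
  move=> /(_ 'X_l1) h; apply: nQ; exists 1%N; rewrite expr1; apply: h.
  by rewrite mcoeffX mnm1_eq0.
Qed.

End HighCohomology.

(** * The socle of the top cohomology *)

Section SocleDual.
Variables (k : fieldType) (n r : nat).
Local Notation S := {mpoly k[n]}.
Variables (p : S) (d : nat) (g : 'I_r -> S) (e : 'I_r -> nat) (A : {set 'I_r}).
Hypotheses (hp : p \is d.-homog) (hg : forall l, g l \is (e l).-homog).
Hypothesis pA : ~ ideal_gen g A p.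

Local Notation T := 'X_{1..n < d.+1}.

Definition coef_pairing (E : 'X_{1..n} -> k) (q : S) : k := \sum_(m : T) q@_m * E m.

(** Linear algebra in degree d: p lies outside the span of the products x^s g_l of degree d with l
    in A, so a column of the cokernel matrix separates it; dividing by its value at p normalizes
    it. *)
Lemma separating_functional : exists E : 'X_{1..n} -> k,
  [/\ forall m, mdeg m != d -> E m = 0, coef_pairing E p = 1 &
      forall l, l \in A -> forall s, coef_pairing E ('X_[s] * g l) = 0].
Proof.
pose rowv (q : S) : 'rV[k]_#|{: T}| := \row_j q@_(enum_val j : T).
pose I := ('I_r * T)%type.
pose gen (x : I) : S := if (x.1 \in A) && (mdeg x.2 + e x.1 == d)%N then 'X_[x.2] * g x.1 else 0.
pose U := \matrix_(i < #|{: I}|) rowv (gen (enum_val i)).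
have gen_homog x : gen x \is d.-homog.
  rewrite /gen; case: ifP => [/andP[_ /eqP ed]|_]; last exact: dhomog0.
  have : 'X_[x.2] * g x.1 \is (mdeg x.2 + e x.1).-homog.
    by apply: dhomogM => //; rewrite dhomogX.
  by rewrite [X in X.-homog]ed.
have nsub : ~~ (rowv p <= U)%MS.
  apply/negP => /submxP[D eD]; apply: pA.
  have -> : p = \sum_(x : I) D 0 (enum_rank x) *: gen x.
    apply/mpolyP => m; rewrite raddf_sum /=.
    have [md|md] := eqVneq (mdeg m) d; last first.
      rewrite (dhomog_nemf_coeff hp md) big1 // => x _.
      by rewrite mcoeffZ (dhomog_nemf_coeff (gen_homog x) md) mulr0.
    have mT : (mdeg m < d.+1)%N by rewrite md.
    have /(congr1 (fun v : 'rV_#|{: T}| => v 0 (enum_rank (Sub m mT : T)))) := eD.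
    rewrite !mxE enum_rankK /= => ->.
    rewrite (reindex (enum_val : 'I_#|{: I}| -> I)) /=; last first.
      by exists enum_rank => x _; rewrite ?enum_rankK ?enum_valK.
    by apply: eq_bigr => i _; rewrite !mxE enum_rankK mcoeffZ enum_valK.
  exists (fun l => \sum_(s : T) if (mdeg s + e l == d)%N then D 0 (enum_rank (l, s)) *: 'X_[s] else 0).
  transitivity (\sum_(l : 'I_r) \sum_(s : T) D 0 (enum_rank (l, s)) *: gen (l, s)).
    by rewrite pair_bigA; apply: eq_bigr => -[].
  rewrite [RHS]big_mkcond.
  apply: eq_bigr => l _; rewrite /gen /=; case: ifP => lA /=.
    rewrite mulr_suml; apply: eq_bigr => s _; case: ifP => _; rewrite ?mul0r ?scaler0 //.
    by rewrite scalerAl.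
  by rewrite big1 // => s _; rewrite scaler0.
have : rowv p *m cokermx U != 0 by rewrite -submxE.
case/rV0Pn => j0 nz; pose a := (rowv p *m cokermx U) 0 j0.
pose E m := if insub m is Some m' then
   (if mdeg m == d then (cokermx U) (enum_rank (m' : T)) j0 / a else 0) else 0.
have lamE q : q \is d.-homog -> coef_pairing E q = (rowv q *m cokermx U) 0 j0 / a.
  move=> hq; rewrite /coef_pairing mxE mulr_suml (reindex (enum_val : 'I_#|{: T}| -> T)) /=; last first.
    by exists enum_rank => x _; rewrite ?enum_rankK ?enum_valK.
  apply: eq_bigr => i _; rewrite /E mxE valK; case: ifPn => [_|md].
    by rewrite enum_valK mulrA.
  by rewrite (dhomog_nemf_coeff hq md) !mul0r.
exists E; split=> [m md||l lA s].
- by rewrite /E (negbTE md); case: insub.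
- by rewrite lamE // divff.
- have [es|ne] := eqVneq (mdeg s + e l)%N d; last first.
    have hs : 'X_[s] * g l \is (mdeg s + e l).-homog by apply: dhomogM => //; rewrite dhomogX.
    rewrite /coef_pairing big1 // => m _; have [md|md] := eqVneq (mdeg m) d.
      by rewrite (dhomog_nemf_coeff hs) ?mul0r //= md eq_sym.
    by rewrite /E (negbTE md); case: insub => *; rewrite mulr0.
  have sT : (mdeg s < d.+1)%N by rewrite ltnS -es leq_addr.
  have eg : 'X_[s] * g l = gen (l, Sub s sT : T) by rewrite /gen /= lA es eqxx.
  rewrite eg lamE //.
  have -> : rowv (gen (l, Sub s sT)) = row (enum_rank (l, Sub s sT : T)) U.
    by apply/rowP => j; rewrite !mxE enum_rankK.
  by rewrite -row_mul mulmx_coker row0 mxE mul0r.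
Qed.

(* G / (x_1 ... x_n) ^ (D + 1) is the class of H^n(S) dual to a functional on the
   forms of degree d that is 1 on p and vanishes on the ideal of the g_l, l in A;
   a product vanishes in H^n(S) iff it has no monomial with all exponents <= D. *)
Lemma socle_dual D : (d <= D)%N -> exists G : S,
  G \is (n * D - d).-homog /\
  forall m : 'X_{1..n}, (forall i, (m i <= D)%N) ->
    (G * p)@_m = (m == [multinom D | i < n])%:R /\
    forall l, l \in A -> (G * g l)@_m = 0.
Proof.
move=> dD; have [E [E0 Ep Eg]] := separating_functional.
pose c : 'X_{1..n} := [multinom D | i < n].
have cE i : c i = D by rewrite mnmE.
have mc : mdeg c = (n * D)%N.
  by rewrite mdegE (eq_bigr (fun=> D)) ?sum_nat_const ?card_ord // => i _; rewrite mnmE.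
pose Ec (m : 'X_{1..n}) := if (m <= c)%MM then E (c - m)%MM else 0.
pose K := (n * D).+1.
(* Macaulay's inverse system: reversing exponents within the box [0, D]^n turns multiplication by q
   into contraction, so that for m in the box the coefficient of x^m in G q is E applied to x^(c-m)
   q. *)
pose G : S := \sum_(m : 'X_{1..n < K}) Ec m *: 'X_[m].
have Gc m : (m <= c)%MM -> G@_m = E (c - m)%MM.
  move=> le; rewrite /G mcoeff_mpoly /Ec ?le //.
  by rewrite ltnS -mc -(submK le) mdegD leq_addl.
have lamX m : coef_pairing E 'X_[m] = E m.
  have [md|md] := ltnP (mdeg m) d.+1.
    rewrite /coef_pairing (bigD1 (Sub m md : T)) //= mcoeffX eqxx mul1r big1 ?addr0 // => m' ne.
    rewrite mcoeffX; case: eqVneq => [e'|]; last by rewrite mul0r.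
    by case/eqP: ne; apply: val_inj; rewrite /= -e'.
  rewrite E0; last by apply: contraL md => /eqP ->; rewrite -leqNgt.
  rewrite /coef_pairing big1 // => m' _; rewrite mcoeffX; case: eqVneq => [e'|]; last by rewrite mul0r.
  by have := bmdeg m'; rewrite ltnNge -e' md.
have GM q m : (m <= c)%MM -> (G * q)@_m = coef_pairing E ('X_[c - m] * q).
  move=> le; have hm' i : (m i <= D)%N by move/mnm_lepP: le => /(_ i); rewrite cE.
  rewrite [q]mpolyE !mulr_sumr raddf_sum /=.
  have -> : coef_pairing E (\sum_(m1 <- msupp q) 'X_[c - m] * (q@_m1 *: 'X_[m1])) =
            \sum_(m1 <- msupp q) q@_m1 * E (c - m + m1)%MM.
    rewrite /coef_pairing; under eq_bigr => i _ do rewrite raddf_sum mulr_suml.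
    rewrite exchange_big; apply: eq_bigr => m1 _.
    rewrite -lamX /coef_pairing mulr_sumr; apply: eq_bigr => i _.
    by rewrite /= -scalerAr mcoeffZ -mpolyXD mulrA.
  apply: eq_bigr => m1 _; rewrite /= -scalerAr mcoeffZ; congr (_ * _).
  case: (boolP (m1 <= m)%MM) => h.
    rewrite -{1}(submK h) addmC mcoeffMX Gc.
      congr E; apply/mnmP => i; rewrite !(mnmBE, mnmDE).
      by move/mnm_lepP: h => /(_ i); move/mnm_lepP: le => /(_ i); lia.
    by apply: lepm_trans le; apply/mnm_lepP => i; rewrite mnmBE leq_subr.
  rewrite E0.
    apply/memN_msupp_eq0; apply: contra h => /msuppM_le/allpairsP[[m' m''] /= [_ + ->]].
    rewrite msuppX inE => /eqP ->; apply/mnm_lepP => i; rewrite mnmDE; lia.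
  (* Here d <= D enters: if m1 exceeds m at i, then c - m + m1 exceeds D at i and its degree cannot
     be d. *)
  apply: contra h => /eqP dm; apply/mnm_lepP => i.
  have : ((c - m + m1)%MM i <= d)%N by rewrite -dm mdegE (bigD1 i) //= leq_addr.
  rewrite mnmDE mnmBE cE => h'; have := hm' i; lia.
exists G; split.
  apply: rpred_sum => m _; rewrite /Ec; case: ifP => le; last by rewrite scale0r dhomog0.
  have [md|md] := eqVneq (mdeg (c - m)%MM) d; last by rewrite E0 // scale0r dhomog0.
  apply: rpredZ; rewrite dhomogX /= -md -mc -{1}(submK le) mdegD.
  by rewrite addKn.
move=> m hm; have le : (m <= c)%MM by apply/mnm_lepP => i; rewrite cE.
split=> [|l lA]; last by rewrite GM // Eg.
rewrite GM //; case: eqVneq => [->|ne].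
  have -> : (c - c)%MM = 0%MM by apply/mnmP => i; rewrite mnmBE mnm0E subnn.
  by rewrite mpolyX0 mul1r.
have cm0 : mdeg (c - m)%MM != 0%N.
  rewrite mdeg_eq0; apply: contra ne => /eqP/mnmP e0; apply/eqP/mnmP => i.
  by have := e0 i; have := hm i; rewrite mnmBE mnm0E cE; lia.
have hX : 'X_[c - m] * p \is (mdeg (c - m)%MM + d).-homog.
  by apply: dhomogM => //; rewrite dhomogX.
rewrite /coef_pairing big1 // => m' _; have [md|md] := eqVneq (mdeg m') d; last by rewrite E0 ?mulr0.
rewrite (dhomog_nemf_coeff hX) ?mul0r //= md.
by rewrite -{1}[d]add0n eqn_add2r eq_sym.
Qed.

End SocleDual.

Section PowerIdeal.
Variables (k : fieldType) (n : nat) (N : nat).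
Local Notation S := {mpoly k[n]}.

(* Membership in (x_1 ^ N, ..., x_n ^ N), read on the monomials. *)
Definition in_power_ideal (p : S) :=
  forall m : 'X_{1..n}, (forall i, (m i < N)%N) -> p@_m = 0.

Lemma power_ideal_split (e : int) (p : S) : homogz e p -> in_power_ideal p ->
  exists g : 'I_n -> S, (forall l, homogz (e - N%:Z) (g l)) /\
    p = \sum_l 'X_l ^+ N * g l.
Proof.
move=> hp big.
(* Each monomial is assigned to one variable whose exponent in it is at least N. *)
pose hd (m : 'X_{1..n}) := [pick i | (N <= m i)%N].
exists (fun l => \sum_(m <- msupp p | hd m == Some l) p@_m *: 'X_[m - U_(l) *+ N]).
have le m l : hd m == Some l -> (U_(l) *+ N <= m)%MM.
  rewrite /hd; case: pickP => // i hi /eqP[<-]; apply/mnm_lepP => i'.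
  by rewrite mulmnE mnm1E; case: eqVneq => [<-|]; rewrite ?mul1n ?mul0n.
split=> [l|].
  rewrite big_seq_cond; apply: homogz_sum => m /andP[hm /le hl] m' /msuppZ_le.
  rewrite msuppX inE => /eqP ->; rewrite -(hp m hm) -{2}(submK hl) mdegD.
  by rewrite mdegMn mdeg1; lia.
under eq_bigr => l _ do rewrite mulr_sumr big_mkcond.
rewrite exchange_big {1}[p]mpolyE /=; apply: eq_big_seq => m hm.
rewrite -big_mkcond /=.
have [i hi] : exists i, hd m = Some i.
  rewrite /hd; case: pickP => [i _|none]; first by exists i.
  move: hm; rewrite mcoeff_msupp big ?eqxx // => i.
  by rewrite ltnNge none.
rewrite (big_pred1 i) => [|l]; last by rewrite hi /= eq_sym.
rewrite -scalerAr mpolyXn -mpolyXD addmC submK //.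
by apply: le; rewrite hi.
Qed.

End PowerIdeal.

(** * Top cohomology and minimal generators of the Koszul boundaries *)

Section KoszulSocle.
Variables (k : fieldType) (n r : nat) (d : 'I_r -> nat) (f : 'I_r -> {mpoly k[n]}).
Local Notation S := {mpoly k[n]}.
Local Notation ext := (ext k n r).
Hypothesis f_homog : forall l, f l \is (d l).-homog.
Hypothesis f_indep : forall l, ~ ideal_gen f [set~ l] (f l).

Definition ext_unit (Q : {set 'I_r}) : ext := [ffun Q' => (Q' == Q)%:R].

Lemma extBE (u v : ext) (Q : {set 'I_r}) : (u - v) Q = (u Q : S) - (v Q : S) :> S.
Proof. by rewrite !ffunE. Qed.

Lemma koszul_d_unit (C B : {set 'I_r}) :
  koszul_d f (ext_unit C) B =
  \sum_(l | (l \notin B) && (l |: B == C)) (-1) ^+ sg B l * f l.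
Proof.
rewrite ffunE [RHS]big_mkcondr; apply: eq_bigr => l lB.
by rewrite ffunE; case: eqP => _; rewrite ?mulr1 ?mulr0.
Qed.

(** The cycle is G d(e_l /\ e_Q) up to sign, for an l outside Q and G dual to f_l. Its coefficient
    at e_Q is G f_l; each other nonzero coefficient is, up to sign, some G f_l' with l' in Q, which
    lies in the ideal of the x_i^(D+1). *)
Lemma socle_cycle (Q : {set 'I_r}) (D : nat) : (#|Q| < r)%N ->
  (forall l, d l <= D)%N ->
  exists v : ext, [/\ ext_piece d ((n * D)%N%:Z + ext_deg d Q) v,
    ext_in_position #|Q|%:Z v, koszul_d f v = 0 &
    forall Q' (m : 'X_{1..n}), (forall i, (m i < D.+1)%N) ->
      (v Q' : S)@_m = ((Q' == Q) && (m == [multinom D | i < n]))%:R].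
Proof.
move=> Qr dD; have [l lQ] : exists l, l \notin Q.
  apply: contrapT => h; move: Qr; rewrite (_ : Q = setT) ?cardsT ?card_ord ?ltnn //.
  by apply/setP => x; rewrite inE; apply: contrapT => /negP nx; apply: h; exists x.
have nlQ : ~ ideal_gen f Q (f l).
  move=> [c ec]; apply: (f_indep (l := l)); exists (fun l' => if l' \in Q then c l' else 0).
  rewrite {1}ec big_mkcond [RHS]big_mkcond; apply: eq_bigr => l' _; rewrite !inE.
  case: ifP => l'Q; last by rewrite mul0r if_same.
  by rewrite (_ : l' != l) //; apply: contraNneq lQ => <-.
have [G [hG GE]] := socle_dual (f_homog l) f_homog nlQ (dD l).
pose s := (-1) ^+ sg Q l : S.
exists ((s * G) *: koszul_d f (ext_unit (l |: Q))).
have E0 : ext_in_position (#|Q|%:Z + 1) (ext_unit (l |: Q)).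
  move=> A hA; rewrite ffunE; case: eqP => // e; case: hA.
  by rewrite e cardsU1 lQ add1n; lia.
have Ep : ext_piece d (ext_deg d (l |: Q)) (ext_unit (l |: Q)).
  move=> A; rewrite ffunE; case: eqP => [->|_]; last exact: homogz0.
  by rewrite subrr => m; rewrite msupp1 inE => /eqP ->; rewrite mdeg0.
(* For n = 0 the degree n D - d_l is a truncated subtraction; f_l is then a nonzero constant, whence
   d_l = 0. *)
have dlnD : n = 0%N -> d l = 0%N.
  move=> n0; apply/eqP; apply: contrapT => /negP dl; apply: nlQ.
  suff -> : f l = 0 by exists (fun=> 0); rewrite big1 // => i _; rewrite mul0r.
  apply/mpolyP => m; rewrite mcoeff0; apply: (dhomog_nemf_coeff (f_homog l)).
  by rewrite /= mdegE big1 1?eq_sym // => i; have := ltn_ord i; rewrite {2}n0.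
split.
- have hsG : s * G \is (n * D - d l).-homog.
    by rewrite /s -signr_odd; case: odd; rewrite ?expr0 ?expr1 ?mul1r ?mulN1r ?dhomogN.
  have := @gm_pieceZ_eq k n (ext_gm k n d) _ _ ((n * D)%N%:Z + ext_deg d Q) _ _ hsG (koszul_d_piece f_homog Ep).
  apply; rewrite /ext_deg big_setU1 //= PoszD addrA; congr (_ + _).
  case: (posnP n) => [/[dup] n0 /dlnD ->|n0]; first by rewrite n0; lia.
  have : (d l <= n * D)%N by apply: leq_trans (dD l) _; rewrite leq_pmull.
  lia.
- move=> A hA; by rewrite ffunE (koszul_d_position f E0) ?scaler0.
- by rewrite linearZ /= koszul_dd scaler0.
move=> Q' m hm; have [GE1 GE2] := GE m hm.
rewrite ffunE koszul_d_unit scaler_sumr raddf_sum /=.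
have [->|ne] := eqVneq Q' Q.
  rewrite (big_pred1 l) => [|l'] /=; last first.
    apply/andP/eqP => [[l'Q /eqP/setP/(_ l')]|->]; last by rewrite lQ eqxx.
    by rewrite !inE eqxx (negbTE l'Q) !orbF => /esym/eqP.
  rewrite /GRing.scale /= (_ : s * G * _ = G * f l) ?GE1 //.
  rewrite /s; have : ((-1) ^+ sg Q l * (-1) ^+ sg Q l : S) = 1.
    by rewrite -expr2 -signr_odd sqrr_sign.
  move: ((-1) ^+ _) => a aa; transitivity (a * a * (G * f l)); first by ring.
  by rewrite aa mul1r.
rewrite big1 // => l' /andP[l'Q' /eqP e].
have l'Q : l' \in Q.
  have : l' \in l |: Q by rewrite -e setU11.
  rewrite !inE => /predU1P[e'|//]; case/eqP: ne.
  by rewrite -(setU1K l'Q') e e' setU1K.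
rewrite /GRing.scale /= (_ : s * G * _ = s * (-1) ^+ sg Q' l' * (G * f l')); last by ring.
rewrite /s -exprD -signr_odd; have := GE2 l'.
by case: odd; rewrite ?expr0 ?expr1 ?mul1r ?mulN1r ?mcoeffN => -> //; rewrite oppr0.
Qed.

(** A class is lifted to K_(t+1) and read modulo the x_i^(D+1), where the degree bound leaves only
    multiples of the socle elements x^(D, ..., D) e_Q. Subtracting cycles from [socle_cycle] removes
    these without changing the differential. *)
Lemma lc_vanish_boundaries_top (t j : int) : t + 1 < r%:Z -> 
  (forall Q : {set 'I_r}, #|Q|%:Z = t + 1 -> ext_deg d Q <= j + n%:Z) ->
  lc_vanish (koszul_boundaries f_homog t) n j.
Proof.
move=> tr hQ N c hc _.
pose T := [set: 'I_n].
have cT : #|T| = n by rewrite cardsT card_ord.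
have [y [hy ey]] := ses_surj (cycle_term_boundary_ses f_homog t) (hc T).
(* Large enough for [socle_cycle], which needs d_l <= D, and for the exponent D + 1 to be reached
   from N by a push. *)
pose D := (\sum_l d l + N)%N.
have dD l : (d l <= D)%N by rewrite /D (bigD1 l) //= -addnA leq_addr.
have DN : (N <= D.+1)%N by rewrite /D -addnS ltnW // leq_addl.
pose q := (D.+1 - N)%N; have qN : (N + q = D.+1)%N by rewrite subnKC.
pose y1 : ext := xset k T ^+ q *: (term_val k n d (t + 1) y : ext).
have hy1 : ext_piece d (j + (D.+1 * n)%N%:Z) y1.
  apply: (@gm_pieceZ_eq k n (ext_gm k n d) _ _ _ _ _ (xset_homog k T q) hy).
  by rewrite cT -qN; lia.
have /choice[v hv] : forall Q : {set 'I_r}, exists v : ext, #|Q|%:Z = t + 1 ->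
   [/\ ext_piece d ((n * D)%N%:Z + ext_deg d Q) v,
    ext_in_position (t + 1) v, koszul_d f v = 0 &
    forall Q' (m : 'X_{1..n}), (forall i, (m i < D.+1)%N) ->
      (v Q' : S)@_m = ((Q' == Q) && (m == [multinom D | i < n]))%:R].
  move=> Q; case: (eqVneq (#|Q|%:Z) (t + 1)) => [e|/eqP ne]; last by exists 0.
  have [|v hv] := @socle_cycle Q D _ dD; first by lia.
  by exists v => _; rewrite -e.
pose cst : 'X_{1..n} := [multinom D | i < n].
(* By degree, x^(D, ..., D) is the only monomial outside the ideal of the x_i^(D+1) that can occur,
   and it occurs only at Q with deg e_Q = j + n. *)
pose R (Q : {set 'I_r}) := (#|Q|%:Z == t + 1) && (ext_deg d Q == j + n%:Z).
pose y2 : ext := y1 - \sum_(Q | R Q) (((y1 Q : S)@_cst)%:MP : S) *: v Q.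
have cstE i : cst i = D by rewrite mnmE.
have mcst : mdeg cst = (n * D)%N.
  by rewrite mdegE (eq_bigr (fun=> D)) ?sum_nat_const ?card_ord // => i _.
have big_cst (m : 'X_{1..n}) : (forall i, (m i < D.+1)%N) -> (n * D <= mdeg m)%N -> m = cst.
  move=> hm le; have lec : (m <= cst)%MM by apply/mnm_lepP => i; rewrite cstE -ltnS.
  have : mdeg (cst - m)%MM = 0%N.
    by have := mdegD (cst - m)%MM m; rewrite submK // mcst; lia.
  by move/eqP; rewrite mdeg_eq0 => /eqP e0; rewrite -[RHS](submK lec) e0 addmC addm0.
have y1P : ext_in_position (t + 1) y1.
  by move=> A hA; rewrite ffunE (term_val_position y) ?scaler0.
have hC (c0 : k) : (c0%:MP : S) \is 0.-homog.
  apply/dhomogP => m; rewrite msuppC; case: ifP => // _.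
  by rewrite inE => /eqP ->; rewrite /= mdeg0.
have RE Q : R Q -> #|Q|%:Z = t + 1 /\ ext_deg d Q = j + n%:Z by case/andP=> /eqP ? /eqP.
have y2d : koszul_d f y2 = koszul_d f y1.
  rewrite /y2 linearB linear_sum big1 ?subr0 // => Q /RE[hQ1 _].
  by have [_ _ dv _] := hv Q hQ1; rewrite linearZ_LR /= dv scaler0.
have y2P : ext_in_position (t + 1) y2.
  move=> A hA; rewrite extBE y1P // sum_ffunE big1 ?subr0 // => Q /RE[hQ1 _].
  by have [_ vP _ _] := hv Q hQ1; rewrite ffunE vP // scaler0.
have y2h : ext_piece d (j + (D.+1 * n)%N%:Z) y2.
  apply: (@gm_pieceB k n (ext_gm k n d)) => //.
  apply: (@gm_piece_sum k n (ext_gm k n d)) => Q /RE[hQ1 hQ2].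
  have [hvQ _ _ _] := hv Q hQ1.
  by apply: (@gm_pieceZ_eq k n (ext_gm k n d) _ _ _ _ _ (hC _) hvQ); rewrite hQ2; lia.
have y2big Q' : in_power_ideal D.+1 (y2 Q' : S).
  move=> m hm; rewrite extBE mcoeffB sum_ffunE raddf_sum /=.
  rewrite (eq_bigr (fun Q => (y1 Q : S)@_cst * ((Q' == Q) && (m == cst))%:R)); last first.
    move=> Q /RE[hQ1 _]; have [_ _ _ hc'] := hv Q hQ1.
    by rewrite ffunE [X in X@_m]mul_mpolyC mcoeffZ hc'.
  have y1m : (y1 Q' : S)@_m != 0 -> R Q' && (m == cst).
    move=> nz; have Qt : #|Q'|%:Z = t + 1.
      by apply: contrapT => ne; move: nz; rewrite y1P // mcoeff0 eqxx.
    move: nz; rewrite -mcoeff_msupp => /hy1 dm.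
    have := hQ Q' Qt => hQ'; have mc : m = cst by apply: big_cst => //; lia.
    rewrite mc eqxx andbT /R Qt eqxx /=; move: dm; rewrite mc mcst => dm.
    by apply/eqP; lia.
  case: (boolP (R Q' && (m == cst))) => [/andP[RQ /eqP ->]|nR].
    rewrite (bigD1 Q') //= !eqxx mulr1 big1 ?addr0 ?subrr // => Q /andP[_].
    by rewrite eq_sym => /negbTE ->; rewrite mulr0.
  rewrite big1 ?subr0 => [|Q RQ].
    by apply/eqP; apply: contraNT nR => /y1m.
  by case: eqVneq => [e|_] /=; rewrite ?mulr0 //; move: nR; rewrite e RQ /= => /negbTE ->; rewrite mulr0.
have /choice[g hg] : forall Q', exists g : 'I_n -> S,
    (forall l, homogz (j + (D.+1 * n)%N%:Z - ext_deg d Q' - D.+1%:Z) (g l)) /\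
    y2 Q' = \sum_l 'X_l ^+ D.+1 * g l :> S.
  by move=> Q'; apply: power_ideal_split; [apply: y2h | apply: y2big].
pose x l : ext := [ffun Q' : {set 'I_r} => if #|Q'|%:Z == t + 1 then g Q' l else 0].
have xP l : ext_in_position (t + 1) (x l).
  by move=> A /eqP/negbTE hA; rewrite ffunE hA.
have xh l : ext_piece d (j + (D.+1 * n)%N%:Z - D.+1%:Z) (x l).
  move=> A; rewrite ffunE; case: ifP => _; last exact: homogz0.
  by rewrite addrAC; case: (hg A).
have y2E : y2 = \sum_l ('X_l ^+ D.+1 : S) *: x l.
  apply/ffunP => Q'; rewrite sum_ffunE.
  case: (eqVneq (#|Q'|%:Z) (t + 1)) => [e|/eqP ne].
    by rewrite [LHS](proj2 (hg Q')); apply: eq_bigr => l _; rewrite !ffunE e eqxx.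
  by rewrite y2P // big1 // => l _; rewrite ffunE xP // scaler0.
pose X l : koszul_term k n d (t + 1) := GmSub (introT (gs_predP (term_sub k n d (t + 1)) _) (xP l)).
(* The primitive carries, up to sign, the differential of [x l] on the complement of [l]; the factor
   x_l^(D+1) is supplied by the Cech differential. *)
pose b A : koszul_boundaries f_homog t :=
  \sum_(l | A == T :\ l) (-1) ^+ sg T l *: term_to_boundary f_homog t (X l).
exists q, b; rewrite qN; split=> [A|A hA].
  apply: gm_piece_sum => l /eqP ->; apply: gm_piece_sign.
  apply: (ses_g_piece (cycle_term_boundary_ses f_homog t)).
  rewrite (_ : j + _ = j + (D.+1 * n)%N%:Z - D.+1%:Z); first exact: xh.
  have mulS a : n = a.+1 -> (D.+1 * n = D.+1 * a + D.+1)%N.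
    by move=> ->; rewrite mulnS addnC.
  have cTl : n = #|T :\ l|.+1 by have := cardsD1 l T; rewrite cT inE add1n.
  by rewrite (mulS _ cTl); lia.
have -> : A = T by apply/eqP; rewrite eqEcard subsetT hA cT leqnn.
have bT l : b (T :\ l) = (-1) ^+ sg T l *: term_to_boundary f_homog t (X l).
  rewrite /b (big_pred1 l) // => l' /=; apply/eqP/eqP => [|->//].
  by move/setP/(_ l); rewrite !inE eqxx /= andbT => /esym/negbFE/eqP.
rewrite /cech_d (eq_bigr (fun l => 'X_l ^+ D.+1 *: term_to_boundary f_homog t (X l))); last first.
  move=> l _; rewrite bT -/(sg T l) !scalerA; congr (_ *: _).
  rewrite mulrAC -expr2 -signr_odd sqrr_sign; exact: mul1r.
rewrite /cech_push -ey -linearZ_LR.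
under eq_bigr => l _ do rewrite -linearZ_LR.
rewrite -linear_sum; apply: val_inj; apply: val_inj.
rewrite /= -[LHS]y2d y2E; congr (koszul_d f _).
rewrite (eq_bigl predT) => [|l]; last by rewrite inE.
rewrite [RHS](linear_sum (term_val k n d (t + 1))).
by apply: eq_bigr => l _; rewrite linearZ_LR.
Qed.

(** Otherwise Mumford's lemma writes d(e_Q) as a sum of x_l d(y_l), and e_Q - sum_l x_l y_l is a
    cycle with coefficient 1 at e_Q. Its differential at e_(Q \ l0), for l0 in Q, puts f_l0 in the
    ideal of the other generators. *)
Lemma boundaries_not_generated (t : int) (Q : {set 'I_r}) : #|Q|%:Z = t + 1 -> 0 < t + 1 ->
  exists2 p, (p <= n)%N & ~ lc_vanish (koszul_boundaries f_homog t) p (ext_deg d Q - p%:Z).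
Proof.
move=> hQ t0; apply: contrapT => h.
have van p : (p <= n)%N -> lc_vanish (koszul_boundaries f_homog t) p (ext_deg d Q - p%:Z).
  by move=> pn; apply: contrapT => nv; apply: h; exists p.
have eP : ext_in_position (t + 1) (ext_unit Q).
  move=> A hA; rewrite ffunE; case: eqP => // e; by rewrite e in hA.
pose e : koszul_term k n d (t + 1) := GmSub (introT (gs_predP (term_sub k n d (t + 1)) _) eP).
have ep : gm_piece (koszul_term k n d (t + 1)) (ext_deg d Q) e.
  move=> A; rewrite /= ffunE; case: eqP => [->|_]; last exact: homogz0.
  by rewrite subrr => m; rewrite msupp1 inE => /eqP ->; rewrite mdeg0.
have ses := cycle_term_boundary_ses f_homog t.
have [w [hw ew]] := piece_generated_of_lc_vanish van (ses_g_piece ses ep).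
have /choice[y hy] : forall l, exists y, gm_piece (koszul_term k n d (t + 1)) (ext_deg d Q - 1) y /\
    term_to_boundary f_homog t y = w l by move=> l; apply: (ses_surj ses).
pose z : ext := term_val k n d (t + 1) (e - \sum_l 'X_l *: y l).
have dz : koszul_d f z = 0.
  have : term_to_boundary f_homog t (e - \sum_l 'X_l *: y l) = 0.
    rewrite linearB linear_sum ew; apply/eqP; rewrite subr_eq0; apply/eqP.
    by apply: eq_bigr => l _; rewrite linearZ_LR; case: (hy l) => _ ->.
  by move=> /(congr1 val)/(congr1 val).
have zQ : z Q = 1 :> S.
  have zE : z Q = 1 - (\sum_l 'X_l *: (term_val k n d (t + 1) (y l) : ext)) Q :> S.
    have -> : z = ext_unit Q - \sum_l 'X_l *: (term_val k n d (t + 1) (y l) : ext).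
      apply: etrans (_ : _ = (ext_unit Q : ext_gm k n d) - \sum_l 'X_l *: term_val k n d (t + 1) (y l)) _ => //.
      by rewrite /z linearB linear_sum; congr (_ - _).
    by rewrite extBE ffunE eqxx.
  have z0 : (z Q : S)@_0 = 1.
    rewrite zE mcoeffB mcoeff1 eqxx sum_ffunE raddf_sum /= big1 ?subr0 // => l _.
    rewrite [X in X@_0](_ : _ = 'X_l ^+ 1 * ((term_val k n d (t + 1) (y l) : ext) Q : S)).
      by rewrite mcoeffXnM mnm0E.
    by rewrite ffunE expr1.
  have hz : homogz 0 (z Q : S).
    have : gm_piece (koszul_term k n d (t + 1)) (ext_deg d Q) (e - \sum_l 'X_l *: y l).
      apply: gm_pieceB => //; apply: gm_piece_sum => l _.
      apply: gm_pieceZ_eq (XE_homog k l 1) (proj1 (hy l)) _.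
      by rewrite addrCA subrr addr0.
    by move=> /(_ Q); rewrite subrr.
  apply/mpolyP => m; rewrite mcoeff1; case: (eqVneq m 0%MM) => [->//|nm].
  apply/memN_msupp_eq0; apply: contra nm => /hz/eqP.
  by rewrite -mdeg_eq0.
have [l0 l0Q] : exists l0, l0 \in Q.
  by apply/set0Pn; apply/eqP => Q0; move: t0; rewrite -hQ Q0 cards0.
apply: (f_indep (l := l0)).
have /ffunP/(_ (Q :\ l0)) := dz.
rewrite ffunE [RHS]ffunE (bigD1 l0) ?setD11 //= setD1K // zQ mulr1.
set a : S := (-1) ^+ _; set B := \sum_(_ | _) _ => /eqP; rewrite addr_eq0 => /eqP e1.
have aa : a * a = 1 by rewrite -expr2 /a -signr_odd sqrr_sign.
have -> : f l0 = - (a * B) by rewrite -[f l0]mul1r -aa -mulrA e1 mulrN.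
exists (fun l => - (a * (if l \notin Q :\ l0
  then (-1) ^+ #|[set l' in Q :\ l0 | (l' < l)%N]| * (z (l |: Q :\ l0) : S) else 0))).
rewrite /B mulr_sumr -sumrN big_mkcond [RHS]big_mkcond; apply: eq_bigr => l _.
rewrite !inE; case: (eqVneq l l0) => [->|ne] /=; first by [].
rewrite andbT; case: ifP => _; last by rewrite mulr0 oppr0 mul0r.
by rewrite mulNr; congr (- _); rewrite -!mulrA; congr (_ * (_ * _)); rewrite mulrC.
Qed.

End KoszulSocle.

(** * Regularities *)

(** Integer test bounds also separate the two infinities; this turns an equality of regularities
    into an equivalence of bounds. *)
Lemma extint_eq (x y : extint) :
  (forall c : int, (x <= EFin c)%O <-> (y <= EFin c)%O) -> x = y.
Proof.
case: x y => [a||] [b||] h //.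
- have [/(_ (lexx _)) h1 _] := h a; have [_ /(_ (lexx _)) h2] := h b.
  by move: h1 h2; rewrite !lee_fin => h1 h2; congr EFin; apply/eqP; rewrite eq_le h1 h2.
- by have [/(_ (lexx _))] := h a.
- have [_ /(_ (leNye _))] := h (a - 1); rewrite lee_fin; lia.
- by have [_ /(_ (lexx _))] := h b.
- by have [_ /(_ (leNye _))] := h 0.
- have [/(_ (leNye _))] := h (b - 1); rewrite lee_fin; lia.
- by have [/(_ (leNye _))] := h 0.
Qed.

Lemma adde_le_fin (x : extint) (a c : int) :
  (adde x (EFin a) <= EFin c)%O <-> (x <= EFin (c - a))%O.
Proof.
case: x => [b||]; first by rewrite -[adde _ _]/(EFin (b + a)) !lee_fin; lia.
  by split.
by split=> _; exact: leNye.
Qed.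

Lemma regularity_le (k : fieldType) n (M : gradedModule k n) (c : int) :
  (regularity M <= EFin c)%O <-> forall p j, ~ lc_vanish M p j -> j + p%:Z <= c.
Proof.
split=> [/extsup_le h p j /lc_neq0P nv|h].
  have /adde_le_fin/extsup_le/(_ (EFin j)) := h _ (ex_intro _ p erefl).
  by rewrite lee_fin => le; have := le (ex_intro2 _ _ j nv erefl); lia.
apply/extsup_le => _ [p ->]; apply/adde_le_fin/extsup_le => _ [j /lc_neq0P nv ->].
by rewrite lee_fin; have := h p j nv; lia.
Qed.

Lemma bigmax_nat_le (F : nat -> extint) (m n : nat) (y : extint) :
  (\big[Order.max/ENInf int]_(m <= j < n) F j <= y)%O <->
  forall j, (m <= j < n)%N -> (F j <= y)%O.
Proof.
have -> : (forall j, (m <= j < n)%N -> (F j <= y)%O) <->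
          (forall j, j \in index_iota m n -> (F j <= y)%O).
  by split=> h j hj; apply: h; move: hj; rewrite mem_index_iota.
elim: index_iota => [|j s IH]; first by rewrite big_nil; split=> // _; exact: leNye.
rewrite big_cons ge_max; split=> [/andP[h1 /IH h2] j'|h].
  by rewrite inE => /predU1P[->|/h2].
apply/andP; split; first by apply: h; rewrite mem_head.
by apply/IH => j' hj'; apply: h; rewrite inE hj' orbT.
Qed.

Lemma min_generated_indep (k : fieldType) n r (I : set {mpoly k[n]})
    (f : 'I_r -> {mpoly k[n]}) :
  min_generated I f -> forall l, ~ ideal_gen f [set~ l] (f l).
Proof.
move=> [eI hmin] l [c ec].
have pr : [set~ l] \proper [set: 'I_r].
  by rewrite properT; apply/eqP => /setP/(_ l); rewrite !inE eqxx.
apply: (hmin _ pr); rewrite eI; apply/seteqP; split=> p [b eb].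
  exists (fun l' => if l' == l then 0 else b l'); rewrite eb big_mkcond [RHS]big_mkcond.
  by apply: eq_bigr => l' _; rewrite !inE; case: eqP => _; rewrite ?mul0r.
exists (fun l' => b l' + b l * c l'); rewrite eb (bigD1 l) ?inE //=.
under [RHS]eq_bigr => l' _ do rewrite mulrDl -mulrA.
rewrite big_split /= -mulr_sumr -ec addrC; congr (_ + _).
by apply: eq_bigl => l'; rewrite !inE.
Qed.

(** In at most one variable a nonzero homogeneous element is a scalar times a monomial determined by
    its degree, so of two generators one divides the other. *)
Lemma min_generated_nvars (k : fieldType) n r (d : 'I_r -> nat) (f : 'I_r -> {mpoly k[n]}) :
  (forall l, f l \is (d l).-homog) -> (forall l, ~ ideal_gen f [set~ l] (f l)) ->
  (1 < r)%N -> (1 < n)%N.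
Proof.
move=> hf indep r1; rewrite ltnNge; apply/negP => n1.
have mE (m : 'X_{1..n}) (i : 'I_n) : m i = mdeg m.
  rewrite mdegE (bigD1 i) //= big1 ?addn0 // => i' /eqP[]; apply: val_inj => /=.
  by have := ltn_ord i; have := ltn_ord i'; lia.
have nz l : f l != 0.
  apply/eqP => e; apply: (indep l); exists (fun=> 0).
  by rewrite e big1 // => i _; rewrite mul0r.
have fE l : exists2 m : 'X_{1..n}, mdeg m = d l & exists2 a, a != 0 & f l = a *: 'X_[m].
  case e: (msupp (f l)) => [|m s]; first by move/eqP: e; rewrite msupp_eq0 (negbTE (nz l)).
  have hm : m \in msupp (f l) by rewrite e mem_head.
  have dm := dhomog_mf (hf l) hm.
  exists m => //; exists (f l)@_m; first by rewrite -mcoeff_msupp.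
  apply/mpolyP => m'; rewrite mcoeffZ mcoeffX; case: eqVneq => [<-|ne]; rewrite ?mulr1 ?mulr0 //.
  apply: (dhomog_nemf_coeff (hf l)); apply: contra ne => /eqP e'.
  by apply/eqP/mnmP => i; rewrite !mE dm e'.
have key l l' : l != l' -> (d l <= d l')%N -> False.
  move=> ne le; apply: (indep l'); have [m dm [a a0 ea]] := fE l; have [m' dm' [a' _ ea']] := fE l'.
  have lem : (m <= m')%MM by apply/mnm_lepP => i; rewrite !mE dm dm'.
  exists (fun l1 => if l1 == l then (a' / a) *: 'X_[m' - m] else 0).
  rewrite (bigD1 l) ?inE //= eqxx big1 ?addr0 => [|i /andP[_ /negbTE ->]]; last by rewrite mul0r.
  by rewrite ea ea' -scalerAl -scalerAr -mpolyXD scalerA divfK // submK.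
pose l0 := Ordinal (ltnW r1); pose l1 := Ordinal r1.
by have [/key|/ltnW/key] := leqP (d l0) (d l1); apply.
Qed.

(** * Cohomology of cycles and boundaries in terms of the homology *)

Section Cohomology.
Variables (k : fieldType) (n r : nat) (d : 'I_r -> nat) (f : 'I_r -> {mpoly k[n]}).
Hypothesis f_homog : forall l, f l \is (d l).-homog.
Hypothesis n_gt1 : (1 < n)%N.
Local Notation B := (koszul_boundaries f_homog).
Local Notation Z := (koszul_cycles f_homog).
Local Notation H := (koszul_homology f_homog).
Local Notation K := (koszul_term k n d).
Hypothesis high : forall t p j, (1 < p)%N -> lc_vanish (H t) p j.
Implicit Types (t j : int) (p : nat).

Lemma boundary_cycle_homology_ses t : @graded_ses k n (B t) (Z t) (H t)
  (gm_incl (boundary_sub f_homog t)) (gm_proj (boundary_sub f_homog t)).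
Proof. exact: sub_quot_ses. Qed.

Lemma lc_vanish_term_lt t p j : (p < n)%N -> lc_vanish (K t) p j.
Proof. by move=> pn; apply: lc_vanish_term; left. Qed.

Lemma lc_vanish_cycles0 t j : lc_vanish (Z t) 0 j.
Proof.
rewrite -(subrK 1 t); apply: lc_vanish_left0 (cycle_term_boundary_ses f_homog (t - 1)) _ _.
by apply: lc_vanish_term_lt; lia.
Qed.

Lemma lc_vanish_boundaries0 t j : lc_vanish (B t) 0 j.
Proof.
apply: lc_vanish_left0 (boundary_cycle_homology_ses t) _ _; exact: lc_vanish_cycles0.
Qed.

Lemma lc_vanish_cyclesS t p j : (p.+1 < n)%N ->
  lc_vanish (B t) p j -> lc_vanish (Z (t + 1)) p.+1 j.
Proof.
move=> pn vB; apply: lc_vanish_left (cycle_term_boundary_ses f_homog t) _ _ vB _.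
exact: lc_vanish_term_lt.
Qed.

Lemma lc_vanish_cycles_inv t p j : (p < n)%N ->
  lc_vanish (Z (t + 1)) p.+1 j -> lc_vanish (B t) p j.
Proof.
move=> pn vZ; apply: lc_vanish_right (cycle_term_boundary_ses f_homog t) _ _ _ vZ.
exact: lc_vanish_term_lt.
Qed.

Lemma lc_vanish_cycles1 t j : lc_vanish (Z t) 1 j.
Proof.
rewrite -(subrK 1 t); apply: lc_vanish_cyclesS => //; exact: lc_vanish_boundaries0.
Qed.

(** H^(p+1)(B_t) lies between H^p(H_t), which vanishes for p > 1, and H^(p+1)(Z_t), which is
    controlled by H^p(B_(t-1)); the induction goes down this staircase to H^1(B_(t-p)). *)
Lemma lc_vanish_boundaries p t j : (p.+1 < n)%N ->
  lc_vanish (H (t - p%:Z)) 0 j -> ((0 < p)%N -> lc_vanish (H (t - p%:Z + 1)) 1 j) ->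
  lc_vanish (B t) p.+1 j.
Proof.
elim: p t => [|p IH] t pn v0 v1; apply: lc_vanish_left (boundary_cycle_homology_ses t) _ _ _ _.
- by rewrite subr0 in v0.
- exact: lc_vanish_cycles1.
- case: p v1 {IH v0 pn} => [/(_ isT)|p _]; last exact: high.
  by rewrite subrK.
- rewrite -(subrK 1 t); apply: lc_vanish_cyclesS => //; apply: IH; first exact: ltnW.
    by rewrite (_ : t - 1 - p%:Z = t - p.+1%:Z) //; lia.
  move=> _; rewrite (_ : t - 1 - p%:Z + 1 = t - p.+1%:Z + 1); first exact: v1.
  by lia.
Qed.

Lemma lc_vanish_cycles_of_boundaries p t j : (1 < p)%N ->
  lc_vanish (B t) p j -> lc_vanish (Z t) p j.
Proof.
move=> p1 vB; apply: lc_vanish_mid (boundary_cycle_homology_ses t) _ _ vB _; exact: high.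
Qed.

(** The staircase in the other direction: H^0(H_(t-p)) embeds in H^1(B_(t-p)) because H^0(Z_(t-p)) =
    0. From there a nonzero class climbs injectively to H^(p+1)(B_t), as H^q(H) = 0 for q > 1. *)
Lemma lc_vanish_homology0 p t j : (p < n)%N ->
  lc_vanish (B t) p.+1 j -> lc_vanish (H (t - p%:Z)) 0 j.
Proof.
elim: p t => [|p IH] t pn vB.
  rewrite subr0; apply: lc_vanish_right (boundary_cycle_homology_ses t) _ _ _ vB.
  exact: lc_vanish_cycles0.
rewrite (_ : t - p.+1%:Z = (t - 1) - p%:Z); last by lia.
apply: IH; first exact: ltnW.
apply: lc_vanish_cycles_inv; rewrite ?subrK //; exact: lc_vanish_cycles_of_boundaries.
Qed.

(** The same climb one degree higher, starting from H^1(H_(t-p)) inside H^2(B_(t-p)) since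
    H^1(Z_(t-p)) = 0. *)
Lemma lc_vanish_homology1 p t j : (p.+1 < n)%N ->
  lc_vanish (B t) p.+2 j -> lc_vanish (H (t - p%:Z)) 1 j.
Proof.
elim: p t => [|p IH] t pn vB.
  rewrite subr0; apply: lc_vanish_right (boundary_cycle_homology_ses t) _ _ _ vB.
  exact: lc_vanish_cycles1.
rewrite (_ : t - p.+1%:Z = (t - 1) - p%:Z); last by lia.
apply: IH; first exact: ltnW.
apply: lc_vanish_cycles_inv; rewrite ?subrK //; exact: lc_vanish_cycles_of_boundaries.
Qed.

Hypothesis f_indep : forall l, ~ ideal_gen f [set~ l] (f l).

Lemma exists_max_ext_deg t : 0 < t + 1 -> t + 1 < r%:Z ->
  exists2 Q : {set 'I_r}, #|Q|%:Z = t + 1 &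
    forall Q' : {set 'I_r}, #|Q'|%:Z = t + 1 -> ext_deg d Q' <= ext_deg d Q.
Proof.
move=> t0 tr; have [m em] : exists m : nat, t + 1 = m%:Z.
  by exists (absz (t + 1)); rewrite gez0_abs // ltW.
rewrite em in t0 tr *; have mr : (m <= r)%N by lia.
pose Q0 := [set l in take m (enum 'I_r)].
have cQ0 : #|Q0| == m.
  rewrite cardsE; move/card_uniqP: (take_uniq m (enum_uniq 'I_r)) => ->.
  by rewrite size_takel // size_enum_ord.
case: (@arg_maxnP _ Q0 (fun Q : {set 'I_r} => #|Q| == m) (fun Q => \sum_(l in Q) d l)%N cQ0).
move=> Q /eqP hQ maxQ; exists Q; first by rewrite hQ.
by move=> Q' [/eqP hQ']; rewrite /ext_deg lez_nat; apply: maxQ.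
Qed.

Lemma koszul_regularity_bound t (c : int) : 0 < t + 1 -> t + 1 < r%:Z ->
  (forall p j, ~ lc_vanish (Z (t + 1)) p j -> j + p%:Z <= c) <->
  (forall s, (1 <= s < n)%N -> forall p j,
     ~ lc_vanish (H (t + 1 - s%:Z)) p j -> j + p%:Z + (s%:Z + 1) <= c).
Proof.
move=> t0 tr; have [Q0 hQ0 maxQ] := exists_max_ext_deg t0 tr.
have top j : ext_deg d Q0 <= j + n%:Z -> lc_vanish (B t) n j.
  move=> le; apply: lc_vanish_boundaries_top => // Q hQ; exact: le_trans (maxQ Q hQ) le.
(* With D = deg e_Q0: this class in degree D - p0 - 1 of H^(p0+1)(B_t) passes to H^(p0+2)(Z_(t+1))
   and contributes D + 1. Cohomological degree n is excluded by [top], degree 0 by H^0(B_t) = 0. *)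
have [p0 p0n np0] : exists2 p, (p.+1 < n)%N & ~ lc_vanish (B t) p.+1 (ext_deg d Q0 - p.+1%:Z).
  have [[|p] pn np] := boundaries_not_generated f_homog f_indep hQ0 t0.
    by case: np; apply: lc_vanish_boundaries0.
  exists p => //; rewrite ltn_neqAle pn andbT; apply/eqP => e; apply: np.
  by rewrite e; apply: top; lia.
split=> [hZ s /andP[s1 sn] p j nv|hH].
  case: p nv => [|[|p]] nv; last by case: nv; apply: high.
    have : ~ lc_vanish (Z (t + 1)) s.+1 j.
      move=> /(lc_vanish_cycles_inv sn); case: s s1 sn nv => // s _ sn nv.
      move=> /(lc_vanish_homology0 (ltnW sn)).
      by rewrite (_ : t - s%:Z = t + 1 - s.+1%:Z) //; lia.
    by move=> /hZ; lia.
  have nB : ~ lc_vanish (B t) s.+1 j.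
    case: s s1 sn nv => // s _ sn nv /(lc_vanish_homology1 sn).
    by rewrite (_ : t - s%:Z = t + 1 - s.+1%:Z) //; lia.
  (* For s = n - 1 the class sits in H^n(B_t) and cannot climb further. By [top] it has degree j < D
     - n, so its contribution j + n + 1 is at most D, below the D + 1 given by p0. *)
  move: sn; rewrite leq_eqVlt => /predU1P[sn|sn].
    have : ~ (ext_deg d Q0 <= j + n%:Z) by move=> /top; rewrite -[X in lc_vanish _ X]sn.
    have : ~ lc_vanish (Z (t + 1)) p0.+2 (ext_deg d Q0 - p0.+1%:Z).
      by move=> /(lc_vanish_cycles_inv p0n).
    by move=> /hZ; lia.
  have : ~ lc_vanish (Z (t + 1)) s.+2 j by move=> /(lc_vanish_cycles_inv sn).
  by move=> /hZ; lia.
(* Both possible sources give the same total j + p + 2: H^0(H_(t-p)) with s = p + 1, and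
   H^1(H_(t-p+1)) with s = p. *)
have hB p j : (p.+1 < n)%N -> ~ lc_vanish (B t) p.+1 j -> j + p.+2%:Z <= c.
  move=> pn nB.
  have [v0|v0] := pselect (lc_vanish (H (t - p%:Z)) 0 j); last first.
    have := hH p.+1 _ 0%N j; rewrite pn (_ : t + 1 - p.+1%:Z = t - p%:Z); last by lia.
    by move=> /(_ isT v0); lia.
  have [p_gt0|p_le0] := ltnP 0 p; last first.
    by case: nB; apply: lc_vanish_boundaries => //; lia.
  have v1 : ~ lc_vanish (H (t - p%:Z + 1)) 1 j.
    by move=> v1; apply: nB; apply: lc_vanish_boundaries.
  have := hH p _ 1%N j; rewrite p_gt0 ltnW // (_ : t + 1 - p%:Z = t - p%:Z + 1); last by lia.
  by move=> /(_ isT v1); lia.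
move=> [|[|p]] j nv; first by case: nv; apply: lc_vanish_cycles0.
  by case: nv; apply: lc_vanish_cycles1.
have [pn|pn|pn] := ltngtP p.+2 n.
- by apply: hB; [exact: ltnW | move=> vB; apply: nv; apply: lc_vanish_cyclesS].
- by case: nv; apply: lc_vanish_gt.
(* A class of H^n(Z_(t+1)) in a degree where H^(n-1)(B_t) vanishes is detected in H^n(K_(t+1)),
   hence j + n <= D, whereas p0 gives D + 1 <= c. *)
have [vB|nB] := pselect (lc_vanish (B t) p.+1 j); last by apply: hB => //; rewrite -pn.
have := hB _ _ p0n np0; suff : j + n%:Z <= ext_deg d Q0 by lia.
rewrite leNgt; apply/negP => lt; apply: nv.
apply: lc_vanish_left (cycle_term_boundary_ses f_homog t) _ _ vB _.
apply: lc_vanish_term; right; split=> // Q hQ; exact: le_lt_trans (maxQ Q hQ) lt.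
Qed.

End Cohomology.

(** * Application to the ideal I and the final comparison *)

Lemma ideal_gen_homog (k : fieldType) n r (d : 'I_r -> nat) (f : 'I_r -> {mpoly k[n]}) A :
  (forall l, f l \is (d l).-homog) -> homog_ideal (ideal_gen f A).
Proof.
move=> hf; split.
- by exists (fun=> 0); rewrite big1 // => l _; rewrite mul0r.
- move=> a u v [b ->] [b' ->]; exists (fun l => a * b l + b' l).
  by rewrite mulr_sumr -big_split; apply: eq_bigr => l _; rewrite mulrDl mulrA.
- move=> e u [b ->].
  exists (fun l => if (d l <= e)%N then pihomog mdeg (e - d l) (b l) else 0).
  rewrite raddf_sum; apply: eq_bigr => l _ /=.
  by rewrite (pihomogM_homog _ _ (hf l)); case: ifP; rewrite ?mul0r.
Qed.

Lemma lc_vanish_homology_high (k : fieldType) n r (d : 'I_r -> nat)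
    (f : 'I_r -> {mpoly k[n]}) (f_homog : forall l, f l \is (d l).-homog) :
  (krull_dim_quot (ideal_gen f [set: 'I_r]) <= EFin (1 : int))%O ->
  forall t p j, (1 < p)%N -> lc_vanish (koszul_homology f_homog t) p j.
Proof.
move=> /(krull_dim_kills_high (ideal_gen_homog _ f_homog))[s [hs ks]] t p j p1.
apply: ks => // a /hs[c ->] z; rewrite scaler_suml big1 // => l _.
by rewrite -scalerA koszul_homology_annihilated scaler0.
Qed.

Theorem theorem4p3 (k : fieldType) (n r : nat) (d : 'I_r -> nat)
  (f : 'I_r -> {mpoly k[n]}) (I : set {mpoly k[n]})
  (f_homog : forall l : 'I_r, f l \is (d l).-homog)
  (f_min : min_generated I f)
  (dim_le1 : (krull_dim_quot I <= EFin (1 : int))%O)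
  (i : int) (i_gt0 : 0 < i) (i_lt_r : i < r%:Z) :
  regularity (koszul_cycles f_homog i) =
  \big[Order.max/ENInf int]_(1 <= j < n)
    adde (regularity (koszul_homology f_homog (i - j%:Z))) (EFin (j%:Z + 1)).
Proof.
have indep := min_generated_indep f_min.
have n1 : (1 < n)%N by apply: (min_generated_nvars f_homog indep); lia.
have high := @lc_vanish_homology_high k n r d f f_homog.
rewrite f_min.1 in dim_le1; have {}high := high dim_le1.
move: i i_gt0 i_lt_r {dim_le1 f_min I}.
suff key t : 0 < t + 1 -> t + 1 < r%:Z -> regularity (koszul_cycles f_homog (t + 1)) =
    \big[Order.max/ENInf int]_(1 <= j < n)
      adde (regularity (koszul_homology f_homog (t + 1 - j%:Z))) (EFin (j%:Z + 1)).
  by move=> i; rewrite -(subrK 1 i); apply: key.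
move=> t0 tr; apply: extint_eq => c.
have bound := koszul_regularity_bound n1 high indep c t0 tr.
split=> [/regularity_le/bound h|/bigmax_nat_le h].
  apply/bigmax_nat_le => s hs; apply/adde_le_fin/regularity_le => p j nv.
  by have := h s hs p j nv; lia.
apply/regularity_le/bound => s hs p j nv.
by have /adde_le_fin/regularity_le/(_ p j nv) := h s hs; lia.
Qed.
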